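(* Let $\mathbb K$ be a field, let $f:\mathbb N^k\to\mathbb N^\ell$ be a surjective monoid homomorphism, and let $\Gamma$ be a row-finite $\ell$-graph with no sources and a finite nonempty set of vertices, which is cofinal and aperiodic. Put $A=\mathrm{KP}_{\mathbb K}(f^*\Gamma)$, $H=\ker\bar f$, $C=\mathbb K[H]$, and for an ideal $J$ of $C$ put $I_J=A\,\iota(J)=\iota(J)A$. Then the map $$\mathrm{Spec}\,C\longrightarrow\mathrm{Spec}\,A,\qquad J\longmapsto I_J,$$ is (well defined and) a homeomorphism. For every field $\mathbb K$, the map $$\mathrm{MaxSpec}\,C\longrightarrow\mathrm{Prim}\,A,\qquad\mathfrak m\longmapsto I_{\mathfrak m},$$ is a homeomorphism onto its image. If $\mathbb K$ is uncountable and algebraically closed, this last map is surjective and hence a homeomorphism.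
   Context: $\mathbb N$ contains $0$. A $k$-graph is a countable small category $\Lambda$ with a functor $d:\Lambda\to\mathbb N^k$ satisfying the factorisation property: if $d(\lambda)=m+n$ there are unique composable $\mu,\nu$ with $\lambda=\mu\nu$, $d(\mu)=m$, $d(\nu)=n$. Objects are identified with $\Lambda^0=d^{-1}(0)$ (vertices); $r,s$ are range and source, and $\mu\nu$ is defined when $s(\mu)=r(\nu)$. Put $v\Lambda^n=\{\lambda: d(\lambda)=n,\ r(\lambda)=v\}$ and $v\Lambda w=\{\lambda:r(\lambda)=v,\ s(\lambda)=w\}$. $\Lambda$ is row-finite if every $v\Lambda^n$ is finite, and has no sources if every $v\Lambda^n$ is nonempty. For a commutative unital ring $R$ and a row-finite $k$-graph $\Lambda$ with no sources, $\mathrm{KP}_R(\Lambda)$ is the universal $R$-algebra generated by $\{p_v:v\in\Lambda^0\}\cup\{s_\lambda,s_{\lambda^*}:\lambda\in\Lambda\setminus\Lambda^0\}$, with $s_v=s_{v^*}=p_v$, subject to: (KP1) the $p_v$ are mutually orthogonal idempotents; (KP2) $s_\lambda s_\mu=s_{\lambda\mu}$ and $s_{\mu^*}s_{\lambda^*}=s_{(\lambda\mu)^*}$ whenever $\lambda\mu$ is defined, and $p_{r(\lambda)}s_\lambda=s_\lambda=s_\lambda p_{s(\lambda)}$, $p_{s(\lambda)}s_{\lambda^*}=s_{\lambda^*}=s_{\lambda^*}p_{r(\lambda)}$; (KP3) if $d(\lambda)=d(\mu)$ then $s_{\lambda^*}s_\mu=\delta_{\lambda,\mu}p_{s(\lambda)}$;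 (KP4) $p_v=\sum_{\lambda\in v\Lambda^n}s_\lambda s_{\lambda^*}$ for $v\in\Lambda^0$, $0\ne n\in\mathbb N^k$. It is unital, with $1=\sum_v p_v$, when $\Lambda^0$ is finite. Infinite paths: $\Gamma^\infty$ is the set of degree-preserving functors $x:\{(p,q):p\le q\in\mathbb N^\ell\}\to\Gamma$ (with $d(x(p,q))=q-p$); $x(n)=x(n,n)$, $v\Gamma^\infty=\{x:x(0)=v\}$, $(\sigma^mx)(p,q)=x(p+m,q+m)$. $\Gamma$ is cofinal if for every $v\in\Gamma^0$ and $x\in\Gamma^\infty$ there is $n\in\mathbb N^\ell$ with $v\Gamma x(n)\ne\varnothing$. $\Gamma$ is aperiodic if for every $v\in\Gamma^0$ there is $x\in v\Gamma^\infty$ with $\sigma^mx\ne\sigma^nx$ whenever $m\ne n$. Pullback: $f^*\Gamma=\{(\lambda,n)\in\Gamma\times\mathbb N^k:d(\lambda)=f(n)\}$, a $k$-graph with degree $d(\lambda,n)=n$ and product $(\lambda,n)(\mu,m)=(\lambda\mu,n+m)$; vertices $(v,0)$ are identified with $v\in\Gamma^0$. $\bar f:\mathbb Z^k\to\mathbb Z^\ell$ is the group completion of $f$. $\mathbb K[H]$ is the group algebra with basis $u_h$ ($h\in H$), $u_hu_g=u_{h+g}$. For $h\in H$ write $h=h_+-h_-$ (coordinatewise positive and negative parts) and put $U_h=\sum_{v\in\Gamma^0}\sum_{\lambda\in v\Gamma^{f(h_+)}}s_{(\lambda,h_+)}s_{(\lambda,h_-)^*}\in A$ (note $f(h_+)=f(h_-)$).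 The map $\iota:\mathbb K[H]\to A$, $u_h\mapsto U_h$, is an injective unital homomorphism with central image. $\mathrm{Spec}\,R$ is the set of proper prime (two-sided) ideals of a ring $R$, and $\mathrm{Prim}\,R$ the set of annihilators of simple left $R$-modules, both with the hull-kernel topology (closed sets: $\{P:P\supseteq I\}$ for two-sided ideals $I$). $\mathrm{MaxSpec}\,C$ is the set of maximal ideals of $C$ with the Zariski topology. *)

(* Defs.v *)
From HB Require Import structures.
From mathcomp Require Import all_boot all_order all_algebra finmap.
From mathcomp Require Import generic_quotient.
From mathcomp Require Import monalg.
From mathcomp Require Import boolp classical_sets cardinality fsbigop functions.
From mathcomp Require Import topology.

Set Implicit Arguments.
Unset Strict Implicit.
Unset Printing Implicit Defensive.

Import Order.TTheory GRing.Theory Num.Theory.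

Local Open Scope classical_set_scope.
Local Open Scope quotient_scope.
Local Open Scope ring_scope.

Section Ideals.
Variable R : pzRingType.
Implicit Types I J P S T : set R.

Definition two_sided_ideal I : Prop :=
  [/\ I 0,
      forall x y, I x -> I y -> I (x + y) &
      forall a x, I x -> I (a * x) /\ I (x * a)].

(* the product S T of two subsets: all finite sums of products *)
Definition mulspan S T : set R :=
  [set x | exists n (a b : 'I_n -> R),
     (forall i, S (a i) /\ T (b i)) /\ x = \sum_(i < n) a i * b i].

Definition prime_ideal P : Prop :=
  [/\ two_sided_ideal P,
      P <> setT &
      forall I J, two_sided_ideal I -> two_sided_ideal J ->
        mulspan I J `<=` P -> I `<=` P \/ J `<=` P].

Definition maximal_ideal P : Prop :=
  [/\ two_sided_ideal P,
      P <> setT &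
      forall I, two_sided_ideal I -> P `<=` I -> I = P \/ I = setT].

Definition submodule (M : lmodType R) (N : set M) : Prop :=
  [/\ N 0,
      forall x y, N x -> N y -> N (x + y) &
      forall a x, N x -> N (a *: x)].

Definition simple_module (M : lmodType R) : Prop :=
  (exists x : M, x <> 0) /\
  forall N : set M, submodule N -> N = [set 0] \/ N = setT.

Definition annihilator (M : lmodType R) : set R :=
  [set a | forall x : M, a *: x = 0].

Definition primitive_ideal P : Prop :=
  exists M : lmodType R, simple_module M /\ P = annihilator M.

Lemma mulspan_mul S T x y : S x -> T y -> mulspan S T (x * y).
Proof.
move=> Sx Ty; exists 1%N, (fun=> x), (fun=> y).
by split=> //; rewrite big_ord_recl big_ord0 addr0.
Qed.

Lemma ideal_sum I n (F : 'I_n -> R) :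
  two_sided_ideal I -> (forall i, I (F i)) -> I (\sum_(i < n) F i).
Proof. by case=> I0 ID _ IF; elim/big_ind: _. Qed.

Lemma proper_ideal1 P : two_sided_ideal P -> P <> setT -> ~ P 1.
Proof.
move=> [_ _ PM] nT P1; apply: nT; apply/seteqP; split=> // x _.
by rewrite -[x]mulr1; case: (PM x 1 P1).
Qed.

Lemma prime_subset : @prime_ideal `<=` @prime_ideal.
Proof. by []. Qed.

Lemma primitive_prime : @primitive_ideal `<=` @prime_ideal.
Proof.
move=> _ [M [[[x0 nx0] simpM] ->]]; split.
- split=> [x|a b Aa Ab x|a b Ab]; first by rewrite scale0r.
    by rewrite scalerDl Aa Ab addr0.
  by split=> x; rewrite -scalerA Ab ?scaler0.
- move=> AT; apply: nx0; rewrite -[x0]scale1r.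
  by have : annihilator M 1 by rewrite AT.
- move=> I J [I0 ID IM] [J0 JD JM] IJ.
  have [|nJ] := pselect (J `<=` annihilator M); [by right|left].
  move/existsNP: nJ => [j /not_implyP [Jj /existsNP [x jx]]].
  pose N : set M := [set y | exists2 b, J b & y = b *: x].
  have subN : submodule N.
    split; first by exists 0; rewrite ?scale0r.
      move=> _ _ [b Jb ->] [c Jc ->]; exists (b + c); first exact: JD.
      by rewrite scalerDl.
    move=> a _ [b Jb ->]; exists (a * b); first by case: (JM a b Jb).
    by rewrite scalerA.
  have [N0|NT] := simpM N subN.
    have Nj : N (j *: x) by exists j.
    by move: Nj; rewrite N0.
  move=> a Ia y; have : N y by rewrite NT.
  move=> [b Jb ->]; rewrite scalerA.
  by apply: (IJ (a * b)); apply: mulspan_mul.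
Qed.

Lemma maximal_prime : @maximal_ideal `<=` @prime_ideal.
Proof.
move=> P [idP nT maxP]; split=> // I J [I0 ID IM] [J0 JD JM] IJ.
have [|nI] := pselect (I `<=` P); [by left|right].
have [P0 PD PM] := idP.
pose Q : set R := [set z | exists i p, [/\ I i, P p & z = i + p]].
have idQ : two_sided_ideal Q.
  split; first by exists 0, 0; rewrite addr0.
    move=> _ _ [i [p [Ii Pp ->]]] [i' [p' [Ii' Pp' ->]]].
    exists (i + i'), (p + p'); split; [exact: ID|exact: PD|].
    by rewrite addrACA.
  move=> a _ [i [p [Ii Pp ->]]]; have [? ?] := IM a i Ii.
  have [? ?] := PM a p Pp; split.
    by exists (a * i), (a * p); rewrite mulrDr.
  by exists (i * a), (p * a); rewrite mulrDl.
have [|QP|QT] := maxP Q idQ; first by move=> p Pp; exists 0, p; rewrite add0r.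
  exfalso; apply: nI => i Ii; rewrite -QP.
  by exists i, 0; rewrite addr0.
move=> j Jj; have [i [p [Ii Pp e1]]] : Q 1 by rewrite QT.
rewrite -[j]mul1r e1 mulrDl; apply: PD; last by case: (PM j p Pp).
by apply: IJ; apply: mulspan_mul.
Qed.

End Ideals.

(* hX is what makes the hulls { P | I `<=` P } the closed sets of a topology:
   see hk_closedP. *)
Definition hull_kernel (R : pzRingType) (X : set (set R))
    (hX : X `<=` @prime_ideal R) : Type := {P : set R | X P}.

Section HullKernel.
Variables (R : pzRingType) (X : set (set R)) (hX : X `<=` @prime_ideal R).
Local Notation T := (hull_kernel hX).

HB.instance Definition _ := gen_eqMixin T.
HB.instance Definition _ := gen_choiceMixin T.

Definition hull (I : set R) : set T := [set P | I `<=` sval P].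

Definition hk_open (U : set T) : Prop :=
  exists2 I, two_sided_ideal I & U = ~` hull I.

Let hk_openT : hk_open setT.
Proof.
exists setT; first by split.
apply/seteqP; split=> // -[P XP] _ /= sTP.
by have [_ + _] := hX XP; apply; apply/seteqP.
Qed.

Let hk_openI : setI_closed hk_open.
Proof.
move=> _ _ [I idI ->] [J idJ ->]; exists (I `&` J).
  have [I0 ID IM] := idI; have [J0 JD JM] := idJ; split=> //.
    by move=> x y [? ?] [? ?]; split; [exact: ID|exact: JD].
  move=> a x [Ix Jx]; have [? ?] := IM a x Ix; have [? ?] := JM a x Jx.
  by split; split.
rewrite -setCU; congr (~` _); apply/seteqP; split=> -[P XP]; rewrite /hull /=.
  by case=> sP x [Ix Jx]; exact: sP.
move=> sP; have [[P0 PD PM] _ primeP] := hX XP; apply: primeP => // x.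
move=> [n [a [b [ab ->]]]]; apply: ideal_sum => // i.
have [Ia Jb] := ab i; have [_ _ IM] := idI; have [_ _ JM] := idJ.
apply: sP; split; first by have [] := IM (b i) (a i) Ia.
by have [] := JM (a i) (b i) Jb.
Qed.

Let hk_open_bigU (A : Type) (F : A -> set T) :
  (forall i, hk_open (F i)) -> hk_open (\bigcup_i F i).
Proof.
move=> oF.
have /boolp.choice[I IF] i :
    exists I : set R, two_sided_ideal I /\ F i = ~` hull I.
  by have [J] := oF i; exists J.
pose K : set R :=
  [set x | forall J, two_sided_ideal J -> (forall i, I i `<=` J) -> J x].
exists K.
  split=> [J [] //|x y Kx Ky J idJ sJ|a x Kx].
    by have [_ JD _] := idJ; apply: JD; [exact: Kx|exact: Ky].
  by split=> J idJ sJ; have [_ _ JM] := idJ; have [] := JM a x (Kx J idJ sJ).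
apply/seteqP; split=> -[P XP].
  move=> [i _]; have [idI ->] := IF i; rewrite /hull /= => nsP sKP.
  by apply: nsP => x Ix; apply: sKP => J _ sJ; apply: (sJ i).
rewrite /hull /= => nKP; apply: contrapT => nU; apply: nKP => x Kx.
apply: Kx; first by have [] := hX XP.
move=> i y Iy; apply: contrapT => nPy; apply: nU; exists i => //.
by have [_ ->] := IF i; rewrite /hull /=; move/(_ y Iy).
Qed.

HB.instance Definition _ :=
  isOpenTopological.Build T hk_openT hk_openI hk_open_bigU.

Lemma hk_closedP (Z : set T) :
  closed Z <-> exists2 I, two_sided_ideal I & Z = hull I.
Proof.
rewrite -openC; split=> -[I idI e]; exists I => //; last by rewrite e.
by rewrite -[Z]setCK e setCK.
Qed.

End HullKernel.

Definition Spec (R : pzRingType) : Type := hull_kernel (@prime_subset R).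
HB.instance Definition _ (R : pzRingType) := Topological.on (Spec R).

Definition Prim (R : pzRingType) : Type := hull_kernel (@primitive_prime R).
HB.instance Definition _ (R : pzRingType) := Topological.on (Prim R).

Definition MaxSpec (R : comPzRingType) : Type :=
  hull_kernel (@maximal_prime R).
HB.instance Definition _ (R : comPzRingType) := Topological.on (MaxSpec R).

Definition homeomorphism (S T : topologicalType) (phi : S -> T) : Prop :=
  exists psi : T -> S,
    [/\ cancel phi psi, cancel psi phi, continuous phi & continuous psi].

Definition corestriction (S T : Type) (phi : S -> T) (x : S) :
    set_type (range phi) :=
  exist _ (phi x) (mem_set (imageT phi x)).

(* set_type carries the subspace topology *)
Definition homeomorphism_onto_image (S T : topologicalType) (phi : S -> T) :
    Prop :=
  homeomorphism (corestriction phi).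

Definition lev k (p q : 'rV[nat]_k) : bool := [forall i, (p ord0 i <= q ord0 i)%N].

(* A small category over the countable set V of objects; an object v is
   identified with the morphism kgid v of degree 0.  The composition
   kgcomp lam mu is only meaningful when kgsrc lam = kgrng mu. *)
Record kgraph (k : nat) (V : countType) := KGraph {
  kgmor :> countType;
  kgrng : kgmor -> V;
  kgsrc : kgmor -> V;
  kgid : V -> kgmor;
  kgcomp : kgmor -> kgmor -> kgmor;
  kgdeg : kgmor -> 'rV[nat]_k;
  kgrng_id : forall v, kgrng (kgid v) = v;
  kgsrc_id : forall v, kgsrc (kgid v) = v;
  kgrng_comp : forall lam mu, kgsrc lam = kgrng mu ->
    kgrng (kgcomp lam mu) = kgrng lam;
  kgsrc_comp : forall lam mu, kgsrc lam = kgrng mu ->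
    kgsrc (kgcomp lam mu) = kgsrc mu;
  kgcompA : forall lam mu nu, kgsrc lam = kgrng mu -> kgsrc mu = kgrng nu ->
    kgcomp lam (kgcomp mu nu) = kgcomp (kgcomp lam mu) nu;
  kgcomp1l : forall lam, kgcomp (kgid (kgrng lam)) lam = lam;
  kgcomp1r : forall lam, kgcomp lam (kgid (kgsrc lam)) = lam;
  kgdeg_id : forall v, kgdeg (kgid v) = 0;
  kgdeg_comp : forall lam mu, kgsrc lam = kgrng mu ->
    kgdeg (kgcomp lam mu) = kgdeg lam + kgdeg mu;
  kg_factorisation : forall lam m n, kgdeg lam = m + n ->
    exists! munu : kgmor * kgmor,
      [/\ kgsrc munu.1 = kgrng munu.2, lam = kgcomp munu.1 munu.2,
          kgdeg munu.1 = m & kgdeg munu.2 = n]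
}.

Section KGraphTheory.
Variables (k : nat) (V : countType) (L : kgraph k V).

Definition paths_from (v : V) (n : 'rV[nat]_k) : set L :=
  [set lam | kgrng lam = v /\ kgdeg lam = n].

Definition row_finite : Prop := forall v n, finite_set (paths_from v n).

Definition no_sources : Prop := forall v n, paths_from v n !=set0.

(* A degree-preserving functor from { (p, q) | p <= q }; ip p q is only
   meaningful for p <= q. *)
Record infinite_path := InfinitePath {
  ip :> 'rV[nat]_k -> 'rV[nat]_k -> L;
  ip_deg : forall p q, lev p q -> p + kgdeg (ip p q) = q;
  ip_id : forall p, ip p p = kgid L (kgrng (ip p p));
  ip_composable : forall p q t, lev p q -> lev q t ->
    kgsrc (ip p q) = kgrng (ip q t);
  ip_comp : forall p q t, lev p q -> lev q t ->
    ip p t = kgcomp (ip p q) (ip q t)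
}.

Definition ip_vertex (x : infinite_path) (n : 'rV[nat]_k) : V :=
  kgrng (x n n).

(* sigma^m x = sigma^n x *)
Definition shift_eq (x : infinite_path) (m n : 'rV[nat]_k) : Prop :=
  forall p q, lev p q -> x (p + m) (q + m) = x (p + n) (q + n).

Definition cofinal : Prop := forall (v : V) (x : infinite_path),
  exists n (lam : L), kgrng lam = v /\ kgsrc lam = ip_vertex x n.

Definition aperiodic : Prop := forall v : V, exists x : infinite_path,
  ip_vertex x 0 = v /\ forall m n, m <> n -> ~ shift_eq x m n.

End KGraphTheory.

Section Pullback.
Variables (k l : nat) (V : countType).
Variables (f : {additive 'rV[nat]_k -> 'rV[nat]_l}) (G : kgraph l V).

Definition pb_pred (x : G * 'rV[nat]_k) : bool := kgdeg x.1 == f x.2.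

Definition pb_mor : Type := {x | pb_pred x}.
HB.instance Definition _ := Countable.on pb_mor.
HB.instance Definition _ := SubType.on pb_mor.

Definition pb_rng (x : pb_mor) : V := kgrng (val x).1.
Definition pb_src (x : pb_mor) : V := kgsrc (val x).1.

Fact pb_id_subproof v : pb_pred (kgid G v, 0).
Proof. by rewrite /pb_pred /= kgdeg_id raddf0. Qed.
Definition pb_id v : pb_mor := exist (fun x => pb_pred x) _ (pb_id_subproof v).

(* the default value x of insubd is only reached on non-composable pairs *)
Definition pb_comp (x y : pb_mor) : pb_mor :=
  insubd x (kgcomp (val x).1 (val y).1, (val x).2 + (val y).2).

Definition pb_deg (x : pb_mor) : 'rV[nat]_k := (val x).2.

Lemma val_pb_comp x y : pb_src x = pb_rng y ->
  val (pb_comp x y) = (kgcomp (val x).1 (val y).1, (val x).2 + (val y).2).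
Proof.
move=> xy; rewrite /pb_comp insubdK // unfold_in /pb_pred /= kgdeg_comp // raddfD.
by rewrite (eqP (valP x)) (eqP (valP y)).
Qed.

Let pb_rng_comp x y : pb_src x = pb_rng y -> pb_rng (pb_comp x y) = pb_rng x.
Proof. by move=> xy; rewrite /pb_rng val_pb_comp //= kgrng_comp. Qed.

Let pb_src_comp x y : pb_src x = pb_rng y -> pb_src (pb_comp x y) = pb_src y.
Proof. by move=> xy; rewrite /pb_src val_pb_comp //= kgsrc_comp. Qed.

Let pb_compA x y z : pb_src x = pb_rng y -> pb_src y = pb_rng z ->
  pb_comp x (pb_comp y z) = pb_comp (pb_comp x y) z.
Proof.
move=> xy yz; apply: val_inj.
rewrite val_pb_comp ?pb_rng_comp // [RHS]val_pb_comp ?pb_src_comp //.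
by rewrite !val_pb_comp //= addrA kgcompA.
Qed.

Let pb_comp1l x : pb_comp (pb_id (pb_rng x)) x = x.
Proof.
apply: val_inj; rewrite val_pb_comp /=; last by rewrite /pb_src /= kgsrc_id.
by rewrite add0r kgcomp1l -surjective_pairing.
Qed.

Let pb_comp1r x : pb_comp x (pb_id (pb_src x)) = x.
Proof.
apply: val_inj; rewrite val_pb_comp /=; last by rewrite /pb_rng /= kgrng_id.
by rewrite addr0 kgcomp1r -surjective_pairing.
Qed.

Let pb_rng_id v : pb_rng (pb_id v) = v. Proof. exact: kgrng_id. Qed.
Let pb_src_id v : pb_src (pb_id v) = v. Proof. exact: kgsrc_id. Qed.
Let pb_deg_id v : pb_deg (pb_id v) = 0. Proof. by []. Qed.

Let pb_deg_comp x y : pb_src x = pb_rng y ->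
  pb_deg (pb_comp x y) = pb_deg x + pb_deg y.
Proof. by move=> xy; rewrite /pb_deg val_pb_comp. Qed.

Let pb_factorisation x m n : pb_deg x = m + n ->
  exists! yz : pb_mor * pb_mor,
    [/\ pb_src yz.1 = pb_rng yz.2, x = pb_comp yz.1 yz.2,
        pb_deg yz.1 = m & pb_deg yz.2 = n].
Proof.
move=> dx; have dfx : kgdeg (val x).1 = f m + f n.
  by rewrite (eqP (valP x)) -raddfD -dx.
have [[mu nu] [/= [munu xE dmu dnu] uniq_munu]] := kg_factorisation dfx.
have Pm : pb_pred (mu, m) by rewrite /pb_pred /= dmu.
have Pn : pb_pred (nu, n) by rewrite /pb_pred /= dnu.
exists (exist (fun x => pb_pred x) _ Pm, exist (fun x => pb_pred x) _ Pn); split.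
  split=> //; apply: val_inj; rewrite val_pb_comp //=.
  by rewrite -xE -dx -surjective_pairing.
move=> [y z] [/= yz xyz dy dz].
have [emu enu] : (mu, nu) = ((val y).1, (val z).1).
  apply: uniq_munu; split=> /=; [exact: yz|by rewrite xyz val_pb_comp| |].
    by rewrite (eqP (valP y)) -dy.
  by rewrite (eqP (valP z)) -dz.
congr (_, _); apply: val_inj => /=.
  by rewrite emu -dy /pb_deg -surjective_pairing.
by rewrite enu -dz /pb_deg -surjective_pairing.
Qed.

Definition pullback : kgraph k V :=
  @KGraph k V pb_mor pb_rng pb_src pb_id pb_comp pb_deg
    pb_rng_id pb_src_id pb_rng_comp pb_src_comp pb_compA pb_comp1l pb_comp1r
    pb_deg_id pb_deg_comp pb_factorisation.

End Pullback.

(* The universal (non-unital) R-algebra on the Kumjian-Pask relations: formal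
   algebra expressions in the generators, modulo the congruence generated by
   the laws of associative R-algebras and the relations.  The generators s_lam,
   s_lam^* are present also for vertices lam, where they are identified with
   p_v. *)
Section KumjianPask.
Variables (R : comPzRingType) (k : nat) (V : countType) (L : kgraph k V).

Inductive kp_term : Type :=
| KPv of V            (* p_v *)
| KPs of L            (* s_lam *)
| KPg of L            (* s_lam^* *)
| KPzero
| KPadd of kp_term & kp_term
| KPopp of kp_term
| KPscale of R & kp_term
| KPmul of kp_term & kp_term.

HB.instance Definition _ := gen_eqMixin kp_term.
HB.instance Definition _ := gen_choiceMixin kp_term.

Implicit Types (a b : R) (x y z : kp_term) (v w : V) (lam mu : L).

Inductive kp_eq : kp_term -> kp_term -> Prop :=
| kp_refl x : kp_eq x x
| kp_sym x y : kp_eq x y -> kp_eq y x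
| kp_trans x y z : kp_eq x y -> kp_eq y z -> kp_eq x z
| kp_add_congr x x' y y' : kp_eq x x' -> kp_eq y y' ->
    kp_eq (KPadd x y) (KPadd x' y')
| kp_opp_congr x x' : kp_eq x x' -> kp_eq (KPopp x) (KPopp x')
| kp_scale_congr a x x' : kp_eq x x' -> kp_eq (KPscale a x) (KPscale a x')
| kp_mul_congr x x' y y' : kp_eq x x' -> kp_eq y y' ->
    kp_eq (KPmul x y) (KPmul x' y')
| kp_addA x y z : kp_eq (KPadd x (KPadd y z)) (KPadd (KPadd x y) z)
| kp_addC x y : kp_eq (KPadd x y) (KPadd y x)
| kp_add0 x : kp_eq (KPadd KPzero x) x
| kp_addN x : kp_eq (KPadd (KPopp x) x) KPzero
| kp_scaleA a b x : kp_eq (KPscale a (KPscale b x)) (KPscale (a * b) x)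
| kp_scale1 x : kp_eq (KPscale 1 x) x
| kp_scaleDr a x y :
    kp_eq (KPscale a (KPadd x y)) (KPadd (KPscale a x) (KPscale a y))
| kp_scaleDl a b x :
    kp_eq (KPscale (a + b) x) (KPadd (KPscale a x) (KPscale b x))
| kp_mulA x y z : kp_eq (KPmul x (KPmul y z)) (KPmul (KPmul x y) z)
| kp_mulDl x y z : kp_eq (KPmul (KPadd x y) z) (KPadd (KPmul x z) (KPmul y z))
| kp_mulDr x y z : kp_eq (KPmul x (KPadd y z)) (KPadd (KPmul x y) (KPmul x z))
| kp_scaleAl a x y : kp_eq (KPscale a (KPmul x y)) (KPmul (KPscale a x) y)
| kp_scaleAr a x y : kp_eq (KPscale a (KPmul x y)) (KPmul x (KPscale a y))
| kp_s_id v : kp_eq (KPs (kgid L v)) (KPv v)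
| kp_g_id v : kp_eq (KPg (kgid L v)) (KPv v)
| kp1_idem v : kp_eq (KPmul (KPv v) (KPv v)) (KPv v)
| kp1_orth v w : v <> w -> kp_eq (KPmul (KPv v) (KPv w)) KPzero
| kp2_s lam mu : kgsrc lam = kgrng mu ->
    kp_eq (KPmul (KPs lam) (KPs mu)) (KPs (kgcomp lam mu))
| kp2_g lam mu : kgsrc lam = kgrng mu ->
    kp_eq (KPmul (KPg mu) (KPg lam)) (KPg (kgcomp lam mu))
| kp2_rs lam : kp_eq (KPmul (KPv (kgrng lam)) (KPs lam)) (KPs lam)
| kp2_ss lam : kp_eq (KPmul (KPs lam) (KPv (kgsrc lam))) (KPs lam)
| kp2_sg lam : kp_eq (KPmul (KPv (kgsrc lam)) (KPg lam)) (KPg lam)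
| kp2_rg lam : kp_eq (KPmul (KPg lam) (KPv (kgrng lam))) (KPg lam)
| kp3_eq lam : kp_eq (KPmul (KPg lam) (KPs lam)) (KPv (kgsrc lam))
| kp3_neq lam mu : kgdeg lam = kgdeg mu -> lam <> mu ->
    kp_eq (KPmul (KPg lam) (KPs mu)) KPzero
(* e is any enumeration without repetition of the finite set v L^n *)
| kp4 v (n : 'rV[nat]_k) (e : seq L) : n <> 0 -> uniq e ->
    (forall lam, lam \in e <-> paths_from v n lam) ->
    kp_eq (KPv v) (\big[KPadd/KPzero]_(lam <- e) KPmul (KPs lam) (KPg lam)).

Definition kp_eqb x y : bool := `[< kp_eq x y >].

Let kp_eqb_refl : reflexive kp_eqb.
Proof. by move=> x; apply/asboolP/kp_refl. Qed.
Let kp_eqb_sym : symmetric kp_eqb.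
Proof. by move=> x y; apply/asboolP/asboolP => /kp_sym. Qed.
Let kp_eqb_trans : transitive kp_eqb.
Proof. by move=> y x z /asboolP xy /asboolP yz; apply/asboolP/(kp_trans xy). Qed.

Canonical kp_equiv := EquivRel kp_eqb kp_eqb_refl kp_eqb_sym kp_eqb_trans.

Definition KP : Type := {eq_quot kp_equiv}.

HB.instance Definition _ := Choice.on KP.
HB.instance Definition _ := EqQuotient.on KP.

Lemma kp_piP x y : (\pi_KP x = \pi_KP y) <-> kp_eq x y.
Proof. by split=> [/eqmodP/asboolP|?] //; apply/eqmodP/asboolP. Qed.

Let kp_reprK (x : KP) : exists t, x = \pi_KP t.
Proof. by exists (repr x); rewrite reprK. Qed.

Definition kp_p v : KP := \pi_KP (KPv v).
Definition kp_s lam : KP := \pi_KP (KPs lam).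
Definition kp_g lam : KP := \pi_KP (KPg lam).

Definition kp_zero : KP := \pi_KP KPzero.
Definition kp_add (x y : KP) : KP := \pi_KP (KPadd (repr x) (repr y)).
Definition kp_opp (x : KP) : KP := \pi_KP (KPopp (repr x)).
Definition kp_scale (a : R) (x : KP) : KP := \pi_KP (KPscale a (repr x)).
Definition kp_mul (x y : KP) : KP := \pi_KP (KPmul (repr x) (repr y)).

Let kp_repr x : kp_eq (repr (\pi_KP x)) x.
Proof. by apply/kp_piP; rewrite reprK. Qed.

Lemma kp_addE x y : kp_add (\pi_KP x) (\pi_KP y) = \pi_KP (KPadd x y).
Proof. by apply/kp_piP; apply: kp_add_congr; apply: kp_repr. Qed.
Lemma kp_oppE x : kp_opp (\pi_KP x) = \pi_KP (KPopp x).
Proof. by apply/kp_piP; apply: kp_opp_congr; apply: kp_repr. Qed.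
Lemma kp_scaleE a x : kp_scale a (\pi_KP x) = \pi_KP (KPscale a x).
Proof. by apply/kp_piP; apply: kp_scale_congr; apply: kp_repr. Qed.
Lemma kp_mulE x y : kp_mul (\pi_KP x) (\pi_KP y) = \pi_KP (KPmul x y).
Proof. by apply/kp_piP; apply: kp_mul_congr; apply: kp_repr. Qed.

Let kpE := (kp_addE, kp_oppE, kp_scaleE, kp_mulE).

Let kp_addrA : associative kp_add.
Proof.
move=> x y z; have [[x' ->] [y' ->] [z' ->]] := And3 (kp_reprK x) (kp_reprK y) (kp_reprK z).
by rewrite !kpE; apply/kp_piP/kp_addA.
Qed.
Let kp_addrC : commutative kp_add.
Proof.
move=> x y; have [[x' ->] [y' ->]] := conj (kp_reprK x) (kp_reprK y).
by rewrite !kpE; apply/kp_piP/kp_addC.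
Qed.
Let kp_add0r : left_id kp_zero kp_add.
Proof.
by move=> x; have [x' ->] := kp_reprK x; rewrite !kpE; apply/kp_piP/kp_add0.
Qed.
Let kp_addNr : left_inverse kp_zero kp_opp kp_add.
Proof.
by move=> x; have [x' ->] := kp_reprK x; rewrite !kpE; apply/kp_piP/kp_addN.
Qed.

HB.instance Definition _ :=
  GRing.isZmodule.Build KP kp_addrA kp_addrC kp_add0r kp_addNr.

Let kp_scalerA a b (x : KP) : kp_scale a (kp_scale b x) = kp_scale (a * b) x.
Proof.
by have [x' ->] := kp_reprK x; rewrite !kpE; apply/kp_piP/kp_scaleA.
Qed.
Let kp_scale1r : left_id 1 kp_scale.
Proof.
by move=> x; have [x' ->] := kp_reprK x; rewrite !kpE; apply/kp_piP/kp_scale1.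
Qed.
Let kp_scalerDr : right_distributive kp_scale +%R.
Proof.
move=> a x y; have [[x' ->] [y' ->]] := conj (kp_reprK x) (kp_reprK y).
by rewrite /GRing.add /= !kpE; apply/kp_piP/kp_scaleDr.
Qed.
Let kp_scalerDl (x : KP) : {morph kp_scale^~ x : a b / a + b}.
Proof.
move=> a b; have [x' ->] := kp_reprK x.
by rewrite [RHS]/GRing.add /= !kpE; apply/kp_piP/kp_scaleDl.
Qed.

HB.instance Definition _ := GRing.Zmodule_isLmodule.Build R KP
  kp_scalerA kp_scale1r kp_scalerDr kp_scalerDl.

Lemma kp_mulrA : associative kp_mul.
Proof.
move=> x y z; have [[x' ->] [y' ->] [z' ->]] := And3 (kp_reprK x) (kp_reprK y) (kp_reprK z).
by rewrite !kpE; apply/kp_piP/kp_mulA.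
Qed.
Lemma kp_mulrDl : left_distributive kp_mul +%R.
Proof.
move=> x y z; have [[x' ->] [y' ->] [z' ->]] := And3 (kp_reprK x) (kp_reprK y) (kp_reprK z).
by rewrite /GRing.add /= !kpE; apply/kp_piP/kp_mulDl.
Qed.
Lemma kp_mulrDr : right_distributive kp_mul +%R.
Proof.
move=> x y z; have [[x' ->] [y' ->] [z' ->]] := And3 (kp_reprK x) (kp_reprK y) (kp_reprK z).
by rewrite /GRing.add /= !kpE; apply/kp_piP/kp_mulDr.
Qed.
Lemma kp_scalerAl a (x y : KP) : a *: kp_mul x y = kp_mul (a *: x) y.
Proof.
have [[x' ->] [y' ->]] := conj (kp_reprK x) (kp_reprK y).
by rewrite /GRing.scale /= !kpE; apply/kp_piP/kp_scaleAl.
Qed.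
Lemma kp_scalerAr a (x y : KP) : a *: kp_mul x y = kp_mul x (a *: y).
Proof.
have [[x' ->] [y' ->]] := conj (kp_reprK x) (kp_reprK y).
by rewrite /GRing.scale /= !kpE; apply/kp_piP/kp_scaleAr.
Qed.

Lemma KP_ind (P : KP -> Prop) :
  (forall v, P (kp_p v)) -> (forall lam, P (kp_s lam)) ->
  (forall lam, P (kp_g lam)) -> P 0 -> (forall x y : KP, P x -> P y -> P (x + y)) ->
  (forall x : KP, P x -> P (- x)) -> (forall a (x : KP), P x -> P (a *: x)) ->
  (forall x y : KP, P x -> P y -> P (kp_mul x y)) -> forall x : KP, P x.
Proof.
move=> Pv Ps Pg P0 PD PN PZ PM x; have [t ->] := kp_reprK x.
elim: t => //.
- by move=> t Pt u Pu; rewrite -kp_addE; apply: PD.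
- by move=> t Pt; rewrite -kp_oppE; apply: PN.
- by move=> a t Pt; rewrite -kp_scaleE; apply: PZ.
- by move=> t Pt u Pu; rewrite -kp_mulE; apply: PM.
Qed.

End KumjianPask.

Arguments kp_p R {k V} L v.
Arguments kp_s R {k V L} lam.
Arguments kp_g R {k V L} lam.

(* For finitely many vertices KP_R(L) is a ring with unit \sum_v p_v; it may
   a priori be the zero ring. *)
Section UnitalKP.
Variables (R : comPzRingType) (k : nat) (V : finType) (L : kgraph k V).
Local Notation A := (KP R L).

Definition kp_one : A := \sum_(v : V) kp_p R L v.

Let mul0 (x : A) : kp_mul 0 x = 0.
Proof. by apply: (addIr (kp_mul 0 x)); rewrite -kp_mulrDl !add0r. Qed.
Let mulr0' (x : A) : kp_mul x 0 = 0.
Proof. by apply: (addIr (kp_mul x 0)); rewrite -kp_mulrDr !add0r. Qed.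

Let kp_orth v w : v != w -> kp_mul (kp_p R L v) (kp_p R L w) = 0.
Proof. by move=> /eqP vw; rewrite kp_mulE; apply/kp_piP/kp1_orth. Qed.

Let one_p w : kp_mul kp_one (kp_p R L w) = kp_p R L w.
Proof.
rewrite /kp_one (big_morph (fun x => kp_mul x _) (fun x y => kp_mulrDl x y _) (mul0 _)).
rewrite (bigD1 w) //= big1 ?addr0; last by move=> v; apply: kp_orth.
by rewrite kp_mulE; apply/kp_piP/kp1_idem.
Qed.

Let p_one w : kp_mul (kp_p R L w) kp_one = kp_p R L w.
Proof.
rewrite /kp_one (big_morph (kp_mul _) (kp_mulrDr _) (mulr0' _)).
rewrite (bigD1 w) //= big1 ?addr0; last by move=> v; rewrite eq_sym; apply: kp_orth.
by rewrite kp_mulE; apply/kp_piP/kp1_idem.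
Qed.

Let kp_mul1r : left_id kp_one (@kp_mul R k V L).
Proof.
apply: KP_ind.
- exact: one_p.
- move=> lam; have e : kp_s R lam = kp_mul (kp_p R L (kgrng lam)) (kp_s R lam).
    by apply/esym; rewrite kp_mulE; apply/kp_piP/kp2_rs.
  by rewrite e kp_mulrA one_p.
- move=> lam; have e : kp_g R lam = kp_mul (kp_p R L (kgsrc lam)) (kp_g R lam).
    by apply/esym; rewrite kp_mulE; apply/kp_piP/kp2_sg.
  by rewrite e kp_mulrA one_p.
- exact: mulr0'.
- by move=> x y x1 y1; rewrite kp_mulrDr x1 y1.
- by move=> x x1; rewrite -scaleN1r -kp_scalerAr x1.
- by move=> a x x1; rewrite -kp_scalerAr x1.
- by move=> x y x1 _; rewrite kp_mulrA x1.
Qed.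

Let kp_mulr1 : right_id kp_one (@kp_mul R k V L).
Proof.
apply: KP_ind.
- exact: p_one.
- move=> lam; have e : kp_s R lam = kp_mul (kp_s R lam) (kp_p R L (kgsrc lam)).
    by apply/esym; rewrite kp_mulE; apply/kp_piP/kp2_ss.
  by rewrite e -kp_mulrA p_one.
- move=> lam; have e : kp_g R lam = kp_mul (kp_g R lam) (kp_p R L (kgrng lam)).
    by apply/esym; rewrite kp_mulE; apply/kp_piP/kp2_rg.
  by rewrite e -kp_mulrA p_one.
- exact: mul0.
- by move=> x y x1 y1; rewrite kp_mulrDl x1 y1.
- by move=> x x1; rewrite -scaleN1r -kp_scalerAl x1.
- by move=> a x x1; rewrite -kp_scalerAl x1.
- by move=> x y _ y1; rewrite -kp_mulrA y1.
Qed.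

HB.instance Definition _ := GRing.Zmodule_isPzRing.Build (KP R L)
  (@kp_mulrA R k V L) kp_mul1r kp_mulr1
  (@kp_mulrDl R k V L) (@kp_mulrDr R k V L).

End UnitalKP.

(* The underlying module is that of {malg K[H]}, whose library product is only
   defined over monoids without nontrivial units; ga_u h is the basis vector
   u_h. *)
Definition grpalg (K : comNzRingType) (H : zmodType) : Type := {malg K[H]}.

Section GroupAlgebra.
Variables (K : comNzRingType) (H : zmodType).
Local Notation C := (grpalg K H).

HB.instance Definition _ := GRing.Lmodule.on C.

Implicit Types (x y z : C) (g h : H).

Definition ga_u h : C := << h >>.

Definition ga_mul x y : C :=
  \sum_(g <- msupp x) \sum_(h <- msupp y) << x@_g * y@_h *g (g + h) >>.

Lemma ga_mulEw (d1 d2 : {fset H}) x y :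
  (msupp x `<=` d1)%fset -> (msupp y `<=` d2)%fset ->
  ga_mul x y = \sum_(g <- d1) \sum_(h <- d2) << x@_g * y@_h *g (g + h) >>.
Proof.
move=> le1 le2; rewrite /ga_mul (big_fset_incl _ le1) /=.
  apply/eq_bigr=> g _; apply/big_fset_incl => // h _ /mcoeff_outdom ->.
  by rewrite mulr0 monalgU0.
move=> g _ /mcoeff_outdom xg; rewrite big1 // => h _.
by rewrite xg mul0r monalgU0.
Qed.

Let ga_mulC : commutative ga_mul.
Proof.
move=> x y; rewrite /ga_mul exchange_big /=; apply/eq_bigr=> h _.
by apply/eq_bigr=> g _; rewrite mulrC addrC.
Qed.

Let ga_mulDl : left_distributive ga_mul +%R.
Proof.
move=> x y z; rewrite (ga_mulEw (msuppD_le x y) (fsubset_refl _)).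
rewrite (ga_mulEw (fsubsetUl (msupp x) (msupp y)) (fsubset_refl (msupp z))).
rewrite (ga_mulEw (fsubsetUr (msupp x) (msupp y)) (fsubset_refl (msupp z))).
rewrite -big_split /=; apply/eq_bigr=> g _.
rewrite -big_split /=; apply/eq_bigr=> h _.
by rewrite mcoeffD mulrDl monalgUD.
Qed.

Let ga_mul0 x : ga_mul 0 x = 0.
Proof. by rewrite /ga_mul msupp0 big_seq_fset0. Qed.

Let ga_mulDr : right_distributive ga_mul +%R.
Proof. by move=> x y z; rewrite ga_mulC ga_mulDl ![ga_mul _ x]ga_mulC. Qed.

Let ga_mulr0 x : ga_mul x 0 = 0.
Proof. by rewrite ga_mulC ga_mul0. Qed.

Let ga_mulUU (a b : K) g h :
  ga_mul << a *g g >> << b *g h >> = << a * b *g (g + h) >>.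
Proof. by rewrite (ga_mulEw msuppU_le msuppU_le) !big_seq_fset1 !mcoeffUU. Qed.

Lemma ga_uD g h : ga_mul (ga_u g) (ga_u h) = ga_u (g + h).
Proof. by rewrite ga_mulUU mulr1. Qed.

Let ga_ind (P : C -> Prop) : P 0 -> (forall x y, P x -> P y -> P (x + y)) ->
  (forall (a : K) h, P << a *g h >>) -> forall x, P x.
Proof. by move=> P0 PD PU x; rewrite [x]monalgE; elim/big_ind: _. Qed.

Let ga_mulA : associative ga_mul.
Proof.
move=> x y z; elim/ga_ind: x => [|x x' Hx Hx'|a g]; first by rewrite !ga_mul0.
  by rewrite !ga_mulDl Hx Hx'.
elim/ga_ind: y => [|y y' Hy Hy'|b h]; first by rewrite !(ga_mul0, ga_mulr0).
  by rewrite !(ga_mulDl, ga_mulDr) Hy Hy'.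
elim/ga_ind: z => [|z z' Hz Hz'|c i]; first by rewrite !ga_mulr0.
  by rewrite !ga_mulDr Hz Hz'.
by rewrite !ga_mulUU mulrA addrA.
Qed.

Let ga_mul1 : left_id (ga_u 0) ga_mul.
Proof.
move=> x; elim/ga_ind: x => [|x x' Hx Hx'|a g]; first by rewrite ga_mulr0.
  by rewrite ga_mulDr Hx Hx'.
by rewrite ga_mulUU mul1r add0r.
Qed.

Let ga_one_neq0 : ga_u 0 != 0.
Proof. by rewrite monalgU_eq0 oner_eq0. Qed.

HB.instance Definition _ := GRing.Zmodule_isComNzRing.Build (grpalg K H)
  ga_mulA ga_mulC ga_mul1 ga_mulDl ga_one_neq0.

Let ga_scaleAl (a : K) (x y : C) : a *: (x * y) = (a *: x) * y.
Proof.
elim/ga_ind: x => [|x x' Hx Hx'|b g]; first by rewrite mul0r !scaler0 mul0r.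
  by rewrite mulrDl !scalerDr mulrDl Hx Hx'.
have aU (c d : K) (h : H) : c *: (<< d *g h >> : C) = << c * d *g h >>.
  by apply/malgP => j; rewrite mcoeffZ !mcoeffU mulrnAr.
elim/ga_ind: y => [|y y' Hy Hy'|c h]; first by rewrite !mulr0 scaler0.
  by rewrite !mulrDr scalerDr Hy Hy'.
by rewrite aU /GRing.mul /= !ga_mulUU aU mulrA.
Qed.

HB.instance Definition _ :=
  GRing.Lmodule_isLalgebra.Build K (grpalg K H) ga_scaleAl.
HB.instance Definition _ := GRing.Lalgebra_isComAlgebra.Build K (grpalg K H).

End GroupAlgebra.

Definition posv k (h : 'rV[int]_k) : 'rV[nat]_k :=
  map_mx (fun z : int => `|Num.max z 0|%N) h.
Definition negv k (h : 'rV[int]_k) : 'rV[nat]_k := posv (- h).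
Definition intv k (n : 'rV[nat]_k) : 'rV[int]_k := map_mx Posz n.

Lemma posv_negv k (h : 'rV[int]_k) : h = intv (posv h) - intv (negv h).
Proof.
apply/matrixP => i j; rewrite !mxE; case: (h i j) => n.
  rewrite max_l // max_r ?subr0 // oppr_le0 //.
by rewrite NegzE opprK max_r // max_l // sub0r.
Qed.

Section GroupCompletion.
Variables (k l : nat) (f : {additive 'rV[nat]_k -> 'rV[nat]_l}).

(* The group completion of f: the additive map extending f, by fbarB and
   fbar_ext. *)
Definition fbar (h : 'rV[int]_k) : 'rV[int]_l :=
  intv (f (posv h)) - intv (f (negv h)).

Lemma intvD m (a b : 'rV[nat]_m) : intv (a + b) = intv a + intv b.
Proof. by apply/matrixP => i j; rewrite !mxE PoszD. Qed.

Lemma intv_inj m : injective (@intv m).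
Proof.
by move=> a b /matrixP ab; apply/matrixP => i j; have := ab i j; rewrite !mxE => -[].
Qed.

Lemma fbar_diff a b : fbar (intv a - intv b) = intv (f a) - intv (f b).
Proof.
set h := intv a - intv b.
have e : posv h + b = a + negv h.
  apply: intv_inj; rewrite !intvD.
  have -> : intv a + intv (negv h) = h + (intv b + intv (negv h)).
    by rewrite addrA subrK.
  by rewrite {2}[h]posv_negv addrCA addrC subrK addrC.
apply/eqP; rewrite /fbar subr_eq addrAC eq_sym subr_eq -!intvD -!raddfD e.
by [].
Qed.

Lemma fbar_ext n : fbar (intv n) = intv (f n).
Proof.
have i0 m : intv (0 : 'rV_m) = 0 by apply/matrixP => i j; rewrite !mxE.
by rewrite -[intv n]subr0 -i0 fbar_diff raddf0 !i0 subr0.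
Qed.

Lemma fbarB : {morph fbar : g h / g - h}.
Proof.
move=> g h.
have -> : g - h = intv (posv g + negv h) - intv (negv g + posv h).
  rewrite {1}[g]posv_negv {1}[h]posv_negv !intvD opprB opprD.
  by rewrite addrACA.
rewrite fbar_diff !raddfD !intvD /fbar /= opprD opprK addrACA.
by congr (_ + _); apply: addrC.
Qed.

Definition ker_fbar_pred : {pred 'rV[int]_k} := fun h => fbar h == 0.

Fact ker_fbar_zmod_closed : zmod_closed ker_fbar_pred.
Proof.
have f0 : fbar 0 = 0 by rewrite -[0 in LHS](subrr (0 : 'rV_k)) fbarB subrr.
split=> [|g h]; first by rewrite unfold_in f0.
by rewrite !unfold_in fbarB => /eqP -> /eqP ->; rewrite subrr.
Qed.

HB.instance Definition _ :=
  GRing.isZmodClosed.Build _ ker_fbar_pred ker_fbar_zmod_closed.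

Record ker_fbar := KerFbar {
  ker_val :> 'rV[int]_k;
  _ : ker_val \in ker_fbar_pred
}.

HB.instance Definition _ := [isSub for ker_val].
HB.instance Definition _ := [Choice of ker_fbar by <:].
HB.instance Definition _ := [SubChoice_isSubZmodule of ker_fbar by <:].

End GroupCompletion.

Section CentralEmbedding.
Variables (K : fieldType) (k l : nat) (V : finType).
Variables (f : {additive 'rV[nat]_k -> 'rV[nat]_l}) (G : kgraph l V).

Local Notation A := (KP K (pullback f G)).
Local Notation H := (ker_fbar f).
Local Notation C := (grpalg K H).

(* s_(lam, n) and s_(lam, n)^*, extended by 0 to the pairs (lam, n) with
   kgdeg lam <> f n *)
Definition pb_s (lam : G) (n : 'rV[nat]_k) : A :=
  if insub (lam, n) is Some x then kp_s K (x : pullback f G) else 0.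
Definition pb_g (lam : G) (n : 'rV[nat]_k) : A :=
  if insub (lam, n) is Some x then kp_g K (x : pullback f G) else 0.

Definition Uh (h : H) : A :=
  \sum_(v : V) \sum_(lam \in paths_from v (f (posv h)))
    pb_s lam (posv h) * pb_g lam (negv h).

(* the K-linear extension of u_h |-> U_h *)
Definition iota_C (c : C) : A := \sum_(h <- msupp c) c@_h *: Uh h.

Definition ideal_AJ (J : set C) : set A := mulspan setT (iota_C @` J).
Definition ideal_JA (J : set C) : set A := mulspan (iota_C @` J) setT.

End CentralEmbedding.

Arguments ideal_AJ {K k l V f} G J.
Arguments ideal_JA {K k l V f} G J.

(* Main.v *)
Require Import Defs.
From HB Require Import structures.
From mathcomp Require Import all_boot all_order all_algebra finmap.
From mathcomp Require Import generic_quotient ring_quotient monalg.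
From mathcomp Require Import boolp classical_sets cardinality fsbigop functions.
From mathcomp Require Import topology.

Set Implicit Arguments.
Unset Strict Implicit.
Unset Printing Implicit Defensive.

Import Order.TTheory GRing.Theory.

Local Open Scope classical_set_scope.
Local Open Scope ring_scope.

(** Write A for the Kumjian-Pask algebra of the pullback, C for the group algebra
    of H, and iota for the embedding of C in the centre of A.  For an ideal J of
    C let extension J be the ideal A iota(J), and for an ideal I of A let
    contraction I be the preimage of I under iota.  Everything follows once these
    two maps are known to be mutually inverse.  They then form an isomorphism
    between the lattices of two-sided ideals, which is compatible with products
    since iota is central; so prime ideals correspond to prime ideals, maximal
    ones to maximal ones, and hulls to hulls (spec_homeomorphism).  A maximal
    ideal of a ring is primitive (maximal_primitive), hence the map from MaxSpec C
    to Prim A.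

    extension (contraction I) = I.  As f is onto, it has an additive section
    (additive_section), and through it A contains a Kumjian-Pask family s_lam,
    t_lam of Gamma itself, such that A is spanned over C by the s_lam t_mu
    (base_span): changing the degree n of a generator s_(lam, n) to another n'
    with f n = f n' amounts to multiplying it by the central unit U_(n - n').
    Given a in I, aperiodicity makes it possible to isolate each coefficient c of a
    as t_mu a s_nu = iota(c) p_v (coefficients_isolated), and cofinality gives
    iota(c) in I from iota(c) p_v in I (cofinal_corner_full).  Hence all
    coefficients of a lie in the contraction of I.

    contraction (extension J) = J.  The algebra A acts on the germs of functions
    from the paths of Gamma to C, two functions being identified when they agree
    on all paths of large degree: s_(lam, n) shifts along lam and multiplies by
    the basis element u_(n - n') with n' the chosen lift of d(lam).  On short
    paths (KP4) fails, which is why germs are needed.  An element c of C acts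
    as multiplication by c and the elements of A iota(J) send everything into J, so
    applying both to the constant function 1 gives the claim
    (contraction_extension_sub).

    Surjectivity onto Prim A.  By Amitsur's trick, a central element of an algebra
    of countable dimension over an uncountable algebraically closed field acts on
    a simple module as a scalar (simple_central_scalar), so the annihilator
    of the module contracts to a maximal ideal of C. *)

(** * Ideals and quotient modules *)

Section MulSpan.
Variable R : pzRingType.
Implicit Types (S T : set R) (x y : R).

Lemma mulspan0 S T : mulspan S T 0.
Proof.
by exists 0%N, (fun=> 0), (fun=> 0); split=> [[]//|]; rewrite big_ord0.
Qed.

Lemma mulspanD S T x y : mulspan S T x -> mulspan S T y -> mulspan S T (x + y).
Proof.
move=> [m [a [b [ab ->]]]] [n [a' [b' [ab' ->]]]].
exists (m + n)%N, (fun i => match fintype.split i with inl j => a j | inr j => a' j end),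
  (fun i => match fintype.split i with inl j => b j | inr j => b' j end); split.
  by move=> i; case: (fintype.split i) => j.
rewrite big_split_ord; congr (_ + _); apply: eq_bigr => i _.
  by rewrite (unsplitK (inl i)).
by rewrite (unsplitK (inr i)).
Qed.

Lemma mulspan_sub S T I : I 0 -> (forall x y, I x -> I y -> I (x + y)) ->
  (forall x y, S x -> T y -> I (x * y)) -> mulspan S T `<=` I.
Proof.
move=> I0 ID IM _ [n [a [b [ab ->]]]].
by elim/big_ind: _ => // i _; apply: IM; have [] := ab i.
Qed.

Lemma two_sided_idealN (I : set R) x : two_sided_ideal I -> I x -> I (- x).
Proof. by move=> [_ _ IM] Ix; rewrite -mulN1r; have [] := IM (-1) x Ix. Qed.

End MulSpan.

Section QuotientModule.
Local Open Scope quotient_scope.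
Variables (R : pzRingType) (M : lmodType R) (N : set M).
Hypothesis subN : submodule N.

Definition submodule_pred : {pred M} := fun x => `[< N x >].

Fact submodule_pred_zmod_closed : zmod_closed submodule_pred.
Proof.
have [N0 ND NZ] := subN; split=> [|x y /asboolP Nx /asboolP Ny]; first exact/asboolP.
by apply/asboolP/ND => //; rewrite -scaleN1r; apply: NZ.
Qed.

HB.instance Definition _ :=
  GRing.isZmodClosed.Build _ submodule_pred submodule_pred_zmod_closed.

Local Notation Q := (Quotient.quot submodule_pred).

Definition quot_scale (a : R) (x : Q) : Q := \pi_Q (a *: repr x).

Let quot_scaleE a x : quot_scale a (\pi_Q x) = \pi_Q (a *: x).
Proof.
have [_ _ NZ] := subN.
apply/eqP; rewrite -Quotient.idealrBE -scalerBr; apply/asboolP/NZ/asboolP.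
by have := Quotient.idealrBE submodule_pred (repr (\pi_Q x)) x; rewrite reprK eqxx.
Qed.

Let quot_ind (P : Q -> Prop) : (forall x, P (\pi_Q x)) -> forall y, P y.
Proof. by move=> HP y; rewrite -[y]reprK. Qed.

Let piD (x y : M) : \pi_Q (x + y) = \pi_Q x + \pi_Q y.
Proof. by rewrite !piE. Qed.

Let quot_scaleA a b (x : Q) : quot_scale a (quot_scale b x) = quot_scale (a * b) x.
Proof. by move: x; apply: quot_ind => x; rewrite !quot_scaleE scalerA. Qed.
Let quot_scale1 : left_id 1 quot_scale.
Proof. by apply: quot_ind => x; rewrite quot_scaleE scale1r. Qed.
Let quot_scaleDr : right_distributive quot_scale +%R.
Proof.
move=> a; apply: quot_ind => x; apply: quot_ind => y.
by rewrite -piD !quot_scaleE scalerDr piD.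
Qed.
Let quot_scaleDl (x : Q) : {morph quot_scale^~ x : a b / a + b}.
Proof. by move: x; apply: quot_ind => x a b; rewrite !quot_scaleE scalerDl piD. Qed.

HB.instance Definition _ := GRing.Zmodule_isLmodule.Build R Q
  quot_scaleA quot_scale1 quot_scaleDr quot_scaleDl.

Lemma quotient_module : exists (L : lmodType R) (q : M -> L),
  [/\ forall x y, q (x + y) = q x + q y, forall a x, q (a *: x) = a *: q x,
      forall y, exists x, y = q x & forall x, q x = 0 <-> N x].
Proof.
exists Q, \pi_Q; split=> [|a x|y|x]; [exact: piD| |by exists (repr y); rewrite reprK|].
  by rewrite -quot_scaleE.
have e0 : \pi_Q 0 = 0 :> Q by rewrite piE.
rewrite -e0 -[x in N x]subr0; split=> [/eqP|Nx].
  by rewrite -Quotient.idealrBE => /asboolP.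
by apply/eqP; rewrite -Quotient.idealrBE; apply/asboolP.
Qed.

End QuotientModule.

(** * Maximal ideals are primitive *)

Section MaximalPrimitive.
Variable R : pzRingType.

Definition left_ideal (L : set R) : Prop := submodule (L : set R^o).

Lemma maximal_left_ideal_ex (P : set R) : left_ideal P -> ~ P 1 ->
  exists L, [/\ left_ideal L, ~ L 1, P `<=` L &
    forall L', left_ideal L' -> ~ L' 1 -> L `<=` L' -> L' = L].
Proof.
move=> lP nP1.
(* Adding P to each member of a chain makes the empty chain harmless. *)
pose ok (L : set R) := left_ideal (L `|` P) /\ ~ (L `|` P) 1.
have [|L [[lL nL1] Lmax]] := @Zorn_bigcup _ ok.
  move=> F Fok Ftot; have [P0 PD PZ] := lP.
  have sub L : F L -> L `|` P `<=` \bigcup_(X in F) X `|` P.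
    by move=> FL x [Lx|Px]; [left; exists L|right].
  split; last by move=> [[L FL L1]|//]; apply: (Fok L FL).2; left.
  split; first by right.
    move=> x y [[L FL Lx]|Px] [[L' FL' Ly]|Py]; last by right; apply: PD.
    - have [LL|LL] := Ftot L L' FL FL'.
        by apply: (sub _ FL'); have [[_ D _] _] := Fok _ FL'; apply: D; left => //; apply: LL.
      by apply: (sub _ FL); have [[_ D _] _] := Fok _ FL; apply: D; left => //; apply: LL.
    - by apply: (sub _ FL); have [[_ D _] _] := Fok _ FL; apply: D; [left|right].
    - by apply: (sub _ FL'); have [[_ D _] _] := Fok _ FL'; apply: D; [right|left].
  move=> a x [[L FL Lx]|Px]; last by right; apply: PZ.
  by apply: (sub _ FL); have [[_ _ Z] _] := Fok _ FL; apply: Z; left.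
exists (L `|` P); split=> // L' lL' nL'1 LL'.
have LP' : L' `|` P = L'.
  by apply/seteqP; split=> x; [case=> // Px; apply: LL'; right|left].
have [LeqL'|ne] := pselect (L' `<=` L).
  by apply/seteqP; split=> // x /LeqL'; left.
exfalso; apply: (Lmax L'); last by rewrite /ok LP'.
by split=> // x Lx; apply: LL'; left.
Qed.

(** The simple module is R / L for a maximal left ideal L above the ideal P; its
    annihilator is a proper ideal containing P, so it is P. *)
Lemma maximal_primitive : @maximal_ideal R `<=` @primitive_ideal R.
Proof.
move=> P [idP nPT maxP]; have [P0 PD PM] := idP.
have nP1 := proper_ideal1 idP nPT.
have lP : left_ideal P by split=> // a x Px; have [] := PM a x Px.
have [L [lL nL1 PL Lmax]] := maximal_left_ideal_ex lP nP1.
have [M [q [qD qZ q_surj q_ker]]] := quotient_module lL.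
have q0 : q 0 = 0 by apply/q_ker; have [] := lL.
have simpM : simple_module M.
  split; first by exists (q 1); move/q_ker.
  move=> S [S0 SD SZ].
  have lS : left_ideal [set x | S (q x)].
    split=> /=; first by rewrite q0.
      by move=> x y Sx Sy; rewrite qD; apply: SD.
    by move=> a x Sx; rewrite qZ; apply: SZ.
  have [S1|nS1] := pselect (S (q 1)).
    right; apply/seteqP; split=> // y _; have [x ->] := q_surj y.
    by have -> : x = x *: (1 : R^o) :> R^o; [rewrite /GRing.scale /= mulr1|rewrite qZ; apply: SZ].
  left; have SL : [set x | S (q x)] = L.
    by apply: Lmax => // x Lx /=; rewrite (q_ker x).2.
  apply/seteqP; split=> [y Sy|y -> //]; have [x E] := q_surj y.
  by rewrite /= E; apply/q_ker; rewrite -SL /= -E.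
have primA : @primitive_ideal R (annihilator M) by exists M.
have [idA nAT _] := primitive_prime primA.
exists M; split=> //; have [|//|//] := maxP _ idA.
move=> a Pa y; have [x ->] := q_surj y.
by rewrite -qZ; apply/q_ker/PL; have [] := PM x a Pa.
Qed.

End MaximalPrimitive.

(** * Extension and contraction of ideals along a central homomorphism *)

Section IdealCorrespondence.
Variables (A : pzRingType) (C : comPzRingType) (io : {rmorphism C -> A}).
Hypothesis io_central : forall c a, io c * a = a * io c.
Implicit Types (I : set A) (J : set C).

Definition extension J : set A := mulspan setT (io @` J).
Definition contraction I : set C := io @^-1` I.

Lemma extensionC J : extension J = mulspan (io @` J) setT.
Proof.
apply/seteqP; split; apply: mulspan_sub; try exact: mulspan0; try exact: mulspanD.
  by move=> a _ _ [c Jc <-]; rewrite -io_central; apply: mulspan_mul => //; exists c.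
by move=> _ a [c Jc <-] _; rewrite io_central; apply: mulspan_mul => //; exists c.
Qed.

Lemma extension_ideal J : two_sided_ideal (extension J).
Proof.
split; [exact: mulspan0|exact: mulspanD|move=> b x Jx].
split; move: x Jx; apply: mulspan_sub => /=; rewrite ?(mulr0, mul0r); try exact: mulspan0.
- by move=> x y; rewrite mulrDr; apply: mulspanD.
- by move=> a z _ Jz; rewrite mulrA; apply: mulspan_mul.
- by move=> x y; rewrite mulrDl; apply: mulspanD.
- move=> a _ _ [c Jc <-]; rewrite -mulrA io_central mulrA.
  by apply: mulspan_mul => //; exists c.
Qed.

Lemma contraction_ideal I : two_sided_ideal I -> two_sided_ideal (contraction I).
Proof.
move=> [I0 ID IM]; rewrite /contraction; split=> /= [|c d Ic Id|c d Id].
- by rewrite rmorph0.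
- by rewrite rmorphD; apply: ID.
- by rewrite !rmorphM; apply: IM.
Qed.

Lemma extension_sub I J : two_sided_ideal I -> (extension J `<=` I) <-> (J `<=` contraction I).
Proof.
move=> [I0 ID IM]; split=> [JI c Jc|JI].
  by apply: JI; rewrite -[io c]mul1r; apply: mulspan_mul => //; exists c.
by apply: mulspan_sub => // a _ _ [c Jc <-]; apply: (IM _ _ _).1; apply: JI.
Qed.

Hypothesis ext_contr : forall I, two_sided_ideal I -> extension (contraction I) = I.
Hypothesis contr_ext : forall J, two_sided_ideal J -> contraction (extension J) = J.

(** With extension and contraction inverse to each other, the adjunction
    extension_sub also holds in the other direction. *)
Lemma contraction_sub I J : two_sided_ideal I -> two_sided_ideal J ->
  (I `<=` extension J) <-> (contraction I `<=` J).
Proof.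
move=> idI idJ; rewrite -{1}(ext_contr idI) extension_sub ?contr_ext //.
exact: extension_ideal.
Qed.

Lemma extension_proper J : two_sided_ideal J -> J <> setT -> extension J <> setT.
Proof. by move=> idJ nT e; apply: nT; rewrite -(contr_ext idJ) e. Qed.

Lemma contraction_proper I : two_sided_ideal I -> I <> setT -> contraction I <> setT.
Proof.
move=> idI nT e; apply: nT; rewrite -(ext_contr idI) e; apply/seteqP; split=> // a _.
by rewrite -[a]mulr1; apply: mulspan_mul => //; exists 1; rewrite ?rmorph1.
Qed.

Lemma extension_prime J : prime_ideal J -> prime_ideal (extension J).
Proof.
move=> [idJ nT primeJ]; split; [exact: extension_ideal|exact: extension_proper|].
move=> I I' idI idI' II'; rewrite !contraction_sub //.
apply: primeJ; [exact: contraction_ideal|exact: contraction_ideal|].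
have [J0 JD _] := idJ; apply: mulspan_sub => // c d Ic Id.
rewrite -(contr_ext idJ) /contraction /= rmorphM.
by apply: II'; apply: mulspan_mul.
Qed.

Lemma contraction_prime I : prime_ideal I -> prime_ideal (contraction I).
Proof.
move=> [idI nT primeI]; split; [exact: contraction_ideal|exact: contraction_proper|].
move=> J J' idJ idJ' JJ'; rewrite -!extension_sub //.
have [I0 ID IM] := idI.
apply: primeI; [exact: extension_ideal|exact: extension_ideal|].
apply: mulspan_sub => // x y Jx J'y; move: x Jx.
apply: mulspan_sub => [|x x' Ix Ix'|a _ _ [c Jc <-]]; first by rewrite mul0r.
  by rewrite mulrDl; apply: ID.
rewrite -mulrA; apply: (IM _ _ _).1; move: y J'y.
apply: mulspan_sub => [|y y' Iy Iy'|b _ _ [d J'd <-]]; first by rewrite mulr0.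
  by rewrite mulrDr; apply: ID.
rewrite mulrA io_central -mulrA; apply: (IM _ _ _).1; rewrite -rmorphM.
by apply: JJ'; apply: mulspan_mul.
Qed.

Lemma extension_maximal J : maximal_ideal J -> maximal_ideal (extension J).
Proof.
move=> [idJ nT maxJ]; split; [exact: extension_ideal|exact: extension_proper|].
move=> I idI; rewrite extension_sub // => JI.
have [e|e] := maxJ _ (contraction_ideal idI) JI; [left|right].
  by rewrite -(ext_contr idI) e.
by apply: contrapT => nI; apply: (contraction_proper idI nI).
Qed.

Lemma extension_primitive J : maximal_ideal J -> primitive_ideal (extension J).
Proof. by move=> /extension_maximal; exact: maximal_primitive. Qed.

Lemma hull_kernel_inj (R : pzRingType) (X : set (set R)) (hX : X `<=` @prime_ideal R)
  (P Q : hull_kernel hX) : sval P = sval Q -> P = Q.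
Proof. by case: P Q => [P XP] [Q XQ] /= PQ; apply: eq_exist. Qed.

Section Topology.
Variables (X : set (set C)) (hX : X `<=` @prime_ideal C).
Variables (Y : set (set A)) (hY : Y `<=` @prime_ideal A).

Lemma extension_continuous (phi : hull_kernel hX -> hull_kernel hY) :
  (forall m, sval (phi m) = extension (sval m)) -> continuous phi.
Proof.
move=> phiE; apply/continuous_closedP => _ /hk_closedP[I idI ->].
apply/hk_closedP; exists (contraction I); first exact: contraction_ideal.
apply/seteqP; split=> m; rewrite /hull /= phiE => H.
  by apply/contraction_sub => //; have [] := hX (svalP m).
by apply/contraction_sub => //; have [] := hX (svalP m).
Qed.

(** Both inverse maps, the one on the whole space and the one on an image, pull
    hulls back to sets of this form. *)
Lemma closed_contraction_hull J : closed [set P : hull_kernel hY | J `<=` contraction (sval P)].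
Proof.
apply/hk_closedP; exists (extension J); first exact: extension_ideal.
by apply/seteqP; split=> P; rewrite /hull /= extension_sub //; have [] := hY (svalP P).
Qed.

Lemma contraction_continuous (phi : hull_kernel hY -> hull_kernel hX) :
  (forall P, sval (phi P) = contraction (sval P)) -> continuous phi.
Proof.
move=> phiE; apply/continuous_closedP => _ /hk_closedP[J idJ ->].
suff -> : phi @^-1` hull J = [set P | J `<=` contraction (sval P)].
  exact: closed_contraction_hull.
by apply/seteqP; split=> P; rewrite /hull /= phiE.
Qed.

End Topology.

Lemma spec_homeomorphism : exists phi : Spec C -> Spec A,
  (forall P, sval (phi P) = extension (sval P)) /\ homeomorphism phi.
Proof.
pose phi (J : Spec C) : Spec A := exist _ _ (extension_prime (svalP J)).
pose psi (I : Spec A) : Spec C := exist _ _ (contraction_prime (svalP I)).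
exists phi; split=> //; exists psi; split.
- by move=> P; apply: hull_kernel_inj; apply: contr_ext; have [] := svalP P.
- by move=> P; apply: hull_kernel_inj; apply: ext_contr; have [] := svalP P.
- exact: extension_continuous.
- exact: contraction_continuous.
Qed.

(** The annihilator of a simple module need not contract to a maximal ideal; where
    it does, the inverse is contraction itself, otherwise it is only defined on
    the image. *)
Lemma maxspec_homeomorphism_onto_image : exists psi : MaxSpec C -> Prim A,
  [/\ forall m, sval (psi m) = extension (sval m),
      homeomorphism_onto_image psi &
      (forall P : Prim A, maximal_ideal (contraction (sval P))) ->
        (forall P, exists m, psi m = P) /\ homeomorphism psi].
Proof.
pose psi (m : MaxSpec C) : Prim A := exist _ _ (extension_primitive (svalP m)).
have psi_cont : continuous psi by exact: extension_continuous.
have idm (m : MaxSpec C) : two_sided_ideal (sval m) by have [] := svalP m.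
exists psi; split=> // [|contr_max]; last first.
  pose chi (P : Prim A) : MaxSpec C := exist _ _ (contr_max P).
  have chiK : cancel chi psi.
    move=> P; apply: hull_kernel_inj; apply: ext_contr.
    by have [] := primitive_prime (svalP P).
  split; first by move=> P; exists (chi P).
  exists chi; split=> //; last exact: contraction_continuous.
  by move=> m; apply: hull_kernel_inj; apply: contr_ext.
have /boolp.choice[chi chiE] (y : set_type (range psi)) : exists m, psi m = set_val y.
  by have [m _ E] := set_mem (valP y); exists m.
have corE m : chi (corestriction psi m) = m.
  apply: hull_kernel_inj; rewrite -[LHS]contr_ext // -[RHS]contr_ext //; congr contraction.
  exact: (congr1 sval (chiE (corestriction psi m))).
exists chi; split=> //.
- by move=> y; apply: val_inj; exact: chiE.
- by apply: continuous_comp_initial.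
- apply/continuous_closedP => _ /hk_closedP[J idJ ->].
  have -> : chi @^-1` hull J = set_val @^-1` [set P : Prim A | J `<=` contraction (sval P)].
    by apply/seteqP; split=> y; rewrite /hull /= -(chiE y) /= contr_ext.
  by apply: closed_comp; [move=> ? _; exact: initial_continuous|exact: closed_contraction_hull].
Qed.

End IdealCorrespondence.

(** * Central elements on simple modules *)

(** A nonzero polynomial over an algebraically closed field is a nonzero constant
    times a product of linear factors. *)
Lemma closed_field_poly_ind (K : fieldType) (P : {poly K} -> Prop) :
  GRing.closed_field_axiom K -> (forall z, z != 0 -> P z%:P) ->
  (forall r q, P q -> P (q * ('X - r%:P))) -> forall q, q != 0 -> P q.
Proof.
move=> closedK Pc PX q; have [n] := ubnP (size q).
elim: n q => // n IH q /ltnSE qn q0.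
have [q1|q1] := leqP (size q) 1.
  have E := size1_polyC q1; rewrite E; apply: Pc.
  by apply: contraNneq q0 => c0; rewrite E c0 polyC0.
pose d := (size q).-1; have d0 : (0 < d)%N by rewrite /d -ltnS prednK // ltnW.
have lq0 : lead_coef q != 0 by rewrite lead_coef_eq0.
have [x Hx] := closedK d (fun i => - (q`_i / lead_coef q)) d0.
have /factor_theorem[q' E] : root q x.
  rewrite /root horner_coef -[size q](prednK (ltnW q1)) -/d big_ord_recr /= Hx.
  rewrite mulr_sumr -big_split big1 // => i _ /=.
  by rewrite /d -lead_coefE mulNr mulrN mulrCA mulrA divfK ?addrN // mulrC.
have q'0 : q' != 0 by apply: contraNneq q0 => q'0; rewrite E q'0 mul0r.
rewrite E; apply: PX; apply: IH => //; apply: leq_trans qn.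
by rewrite E size_Mmonic ?monicXsubC // size_XsubC addn2.
Qed.

Section CentralScalars.
Variables (K : fieldType) (C : comAlgType K) (A : pzRingType).
Variable io : {rmorphism C -> A}.
Hypothesis io_central : forall c a, io c * a = a * io c.
Variable e : nat -> A.
Hypothesis e_span : forall a, exists N (c : nat -> K),
  a = \sum_(i < N) io (c i)%:A * e i.
Hypotheses (K_uncountable : ~ countable [set: K]) (K_closed : GRing.closed_field_axiom K).
Variable M : lmodType A.
Hypothesis simpM : simple_module M.

(** Schur's lemma: a central T acts by an endomorphism, whose kernel and image are
    submodules. *)
Lemma simple_central_bij (T : A) : (forall a, T * a = a * T) ->
  ~ (forall x : M, T *: x = 0) ->
  (forall x : M, T *: x = 0 -> x = 0) /\ (forall y : M, exists x, T *: x = y).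
Proof.
move=> T_central nT; have [_ simp] := simpM.
have TZ a (x : M) : T *: (a *: x) = a *: (T *: x) by rewrite !scalerA T_central.
split=> [x Tx|y].
  have [||K0] := simp [set x | T *: x = 0].
  - split=> /= [|u v Tu Tv|a u Tu]; first by rewrite scaler0.
      by rewrite scalerDr Tu Tv addr0.
    by rewrite TZ Tu scaler0.
  - by move=> K0; have : [set x : M | T *: x = 0] x := Tx; rewrite K0.
  by exfalso; apply: nT => u; have : [set x : M | T *: x = 0] u by rewrite K0.
have [||KT] := simp [set T *: x | x in [set: M]].
- split; first by exists 0; rewrite ?scaler0.
    by move=> _ _ [u _ <-] [v _ <-]; exists (u + v); rewrite ?scalerDr.
  by move=> a _ [u _ <-]; exists (a *: u); rewrite ?TZ.
- move=> K0; exfalso; apply: nT => u.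
  by have : [set T *: x | x in [set: M]] (T *: u); [exists u|rewrite K0].
- by have [x _ <-] : [set T *: x | x in [set: M]] y; [rewrite KT|exists x].
Qed.

(** Amitsur's trick: otherwise all c - z are invertible on M, and the uncountably
    many vectors (c - z)^-1 x0 of the space M of countable dimension satisfy a
    linear relation; clearing denominators, a nonzero polynomial in c, hence a
    product of factors c - r, would kill x0. *)
Lemma simple_central_scalar (c : C) : exists z : K, forall x : M, io (c - z%:A) *: x = 0.
Proof.
apply: contrapT => /forallNP noz.
pose T z := io (c - z%:A).
have Tc z a : T z * a = a * T z by exact: io_central.
have T_inj z := (simple_central_bij (Tc z) (noz z)).1.
have T_surj z := (simple_central_bij (Tc z) (noz z)).2.
have [[x0 nx0] simp] := simpM.
have gen (y : M) : exists a, y = a *: x0.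
  have [||KT] := simp [set a *: x0 | a in [set: A]].
  - split; first by exists 0; rewrite ?scale0r.
      by move=> _ _ [u _ <-] [v _ <-]; exists (u + v); rewrite ?scalerDl.
    by move=> a _ [u _ <-]; exists (a * u); rewrite ?scalerA.
  - move=> K0; exfalso; apply: nx0.
    by have : [set a *: x0 | a in [set: A]] x0; [exists 1; rewrite ?scale1r|rewrite K0].
  - by have : [set a *: x0 | a in [set: A]] y; [rewrite KT|move=> [a _ <-]; exists a].
have /boolp.choice[N HN] z : exists N, exists y (d : nat -> K), T z *: y = x0 /\
    y = \sum_(i < N) (io (d i)%:A * e i) *: x0.
  have [y Ty] := T_surj z x0; have [a ya] := gen y.
  have [N [d ad]] := e_span a; exists N, y, d; split=> //.
  by rewrite ya ad scaler_suml.
have /boolp.choice[y /boolp.choice[d yd]] := HN.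
have [n infn] : exists n, infinite_set [set z | N z = n].
  apply: contrapT => /forallNP fin; apply: K_uncountable.
  have -> : [set: K] = \bigcup_(n in [set: nat]) [set z | N z = n].
    by apply/seteqP; split=> // z _; exists (N z).
  by apply: bigcup_countable => // n _; apply: finite_set_countable; apply: contrapT; exact: fin.
have [B BN nB] := infinite_set_fset n.+1 infn.
set m := #|` B| in nB.
pose w (j : 'I_m) := nth 0 (enum_fset B) j.
have w_inj : injective w.
  by move=> i j /eqP; rewrite nth_uniq ?fset_uniq // => /eqP/val_inj.
have Nw j : N (w j) = n by apply: BN => /=; exact: mem_nth.
(* m > n vectors in the span of n vectors: the coefficient matrix has a kernel. *)
pose D : 'M[K]_(m, n) := \matrix_(j, i) d (w j) i.
have /rowV0Pn[u /sub_kermxP uD nu] : kermx D != 0.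
  rewrite kermx_eq0 -row_leq_rank -ltnNge; apply: leq_ltn_trans nB.
  exact: rank_leq_col.
have rel : \sum_(j < m) io (u ord0 j)%:A *: y (w j) = 0.
  have yE j : y (w j) = \sum_(i < n) (io (d (w j) i)%:A * e i) *: x0.
    by have [_ {1}->] := yd (w j); rewrite Nw.
  under eq_bigr do rewrite yE scaler_sumr.
  rewrite exchange_big big1 //= => i _.
  transitivity ((io (\sum_j u ord0 j * D j i)%:A * e i) *: x0).
    rewrite scaler_suml rmorph_sum mulr_suml scaler_suml; apply: eq_bigr => j _.
    by rewrite mxE scalerA mulrA -rmorphM -scalerAl mul1r scalerA.
  have -> : \sum_j u ord0 j * D j i = (u *m D) ord0 i by rewrite mxE.
  by rewrite uD mxE scale0r rmorph0 mul0r scale0r.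
pose ev (p : {poly K}) := io (horner_alg c p).
have evX z : ev ('X - z%:P) = T z by rewrite /ev rmorphB /= horner_algX horner_algC.
have evM p q : ev (p * q) = ev p * ev q by rewrite /ev !rmorphM.
have evC z : ev z%:P = io z%:A by rewrite /ev horner_algC.
(* q is the relation multiplied by all the c - w i; q(w j) detects u j. *)
pose Q j := \prod_(i < m | i != j) ('X - (w i)%:P).
pose q := \sum_j (u ord0 j)%:P * Q j.
have evq : ev q *: x0 = 0.
  transitivity (ev (\prod_i ('X - (w i)%:P)) *: \sum_(j < m) io (u ord0 j)%:A *: y (w j)).
    rewrite /ev !rmorph_sum scaler_suml scaler_sumr; apply: eq_bigr => j _.
    have [E _] := yd (w j); rewrite -[in LHS]E -evX !scalerA -evC /ev -!rmorphM.
    rewrite (bigD1 j) //=; congr (io (horner_alg _ _) *: _).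
    by rewrite -mulrA mulrC [Q j * _]mulrC.
  by rewrite rel scaler0.
have q0 : q != 0.
  have [j uj] : exists j, u ord0 j != 0.
    apply: contrapT => /forallNP H; move/negP: nu; apply; apply/eqP/rowP => j.
    by rewrite mxE; apply/eqP/negPn/negP/H.
  apply/eqP => /(congr1 (horner^~ (w j)))/eqP; apply/negP.
  rewrite horner0 horner_sum (bigD1 j) //= big1 ?addr0 => [|i ij].
    rewrite hornerM hornerC mulf_neq0 // horner_prod prodf_seq_neq0.
    apply/allP => i _; apply/implyP => ij.
    by rewrite hornerXsubC subr_eq0 eq_sym; apply: contraNneq ij => /w_inj ->.
  rewrite hornerM horner_prod (bigD1 j) 1?eq_sym //=.
  by rewrite hornerXsubC subrr mul0r mulr0.
suff ev_inj : forall x : M, ev q *: x = 0 -> x = 0 by apply/nx0/ev_inj.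
pose P p := forall x : M, ev p *: x = 0 -> x = 0.
apply: (@closed_field_poly_ind K P K_closed _ _ q q0) => [z z0|r p IH] x.
  rewrite evC => /(congr1 ( *:%R (io (z^-1)%:A))).
  by rewrite scaler0 scalerA -rmorphM -scalerAl mul1r scalerA mulVf // scale1r rmorph1 scale1r.
by rewrite evM evX -scalerA => /IH /T_inj.
Qed.

(** Modulo this ideal each c equals a scalar, so the quotient of C by it is K. *)
Lemma annihilator_contraction_maximal :
  maximal_ideal (io @^-1` annihilator M).
Proof.
have [[x0 nx0] _] := simpM.
have ann1 : ~ annihilator M 1 by move=> /(_ x0); rewrite scale1r.
have idJ : two_sided_ideal (io @^-1` annihilator M).
  split=> /= [x|a b Ja Jb x|a b Jb]; first by rewrite rmorph0 scale0r.
    by rewrite rmorphD scalerDl Ja Jb addr0.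
  by rewrite [b * a]mulrC rmorphM; split=> x; rewrite -scalerA Jb scaler0.
split=> //.
  move=> JT; apply: ann1; rewrite -(rmorph1 io).
  by have : (io @^-1` annihilator M) 1 by rewrite JT.
move=> I [I0 ID IM] JI.
have [IJ|/existsNP[c /not_implyP[Ic nJc]]] := pselect (I `<=` io @^-1` annihilator M).
  by left; apply/seteqP.
right; apply/seteqP; split=> // b _.
have [z Hz] := simple_central_scalar c.
have z0 : z != 0.
  by apply/eqP => z0; apply: nJc => x; have := Hz x; rewrite z0 scale0r subr0.
have Iz : I z%:A.
  have -> : z%:A = c + (-1) * (c - z%:A) by rewrite mulN1r opprB addrC subrK.
  by apply: ID => //; apply: (IM _ _ _).1; apply: JI.
have -> : b = (b * (z^-1)%:A) * z%:A.
  by rewrite -mulrA -scalerAl mul1r scalerA mulVf // scale1r mulr1.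
exact: (IM _ _ Iz).1.
Qed.

End CentralScalars.

(** * Factorisation in k-graphs *)

Section NatVectors.
Variable k : nat.
Implicit Types p q m n : 'rV[nat]_k.

Lemma rowN_addIr m n p : m + p = n + p -> m = n.
Proof.
by move=> /matrixP e; apply/matrixP => i j; have := e i j; rewrite !mxE => /addIn.
Qed.

Lemma rowN_addrI m n p : p + m = p + n -> m = n.
Proof. by rewrite ![p + _]addrC => /rowN_addIr. Qed.

Lemma levP p q : reflect (exists n, p + n = q) (lev p q).
Proof.
apply: (iffP forallP) => [le_pq|[n <-] i]; last by rewrite mxE leq_addr.
exists (\row_j (q ord0 j - p ord0 j)%N); apply/matrixP => i j.
by rewrite !mxE ord1; apply: subnKC.
Qed.

Lemma lev_addr p n : lev p (p + n). Proof. by apply/levP; exists n. Qed.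
Lemma lev_refl p : lev p p. Proof. by apply/forallP. Qed.
Lemma lev0 p : lev 0 p. Proof. by apply/levP; exists p; rewrite add0r. Qed.
Lemma lev_trans q p n : lev p q -> lev q n -> lev p n.
Proof. by move=> /levP[a <-] /levP[b <-]; rewrite -addrA lev_addr. Qed.

End NatVectors.

Section KGraphFactorisation.
Variables (k : nat) (V : countType) (L : kgraph k V).
Implicit Types (lam mu nu al be : L) (m n : 'rV[nat]_k).

Lemma kg_factor lam m n : kgdeg lam = m + n ->
  exists mu nu, [/\ kgsrc mu = kgrng nu, lam = kgcomp mu nu, kgdeg mu = m & kgdeg nu = n].
Proof. by move=> /kg_factorisation[[mu nu] [[? ? ? ?] _]]; exists mu, nu. Qed.

Lemma kg_cancel lam mu al be : kgsrc lam = kgrng mu -> kgsrc al = kgrng be ->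
  kgdeg lam = kgdeg al -> kgcomp lam mu = kgcomp al be -> lam = al /\ mu = be.
Proof.
move=> lm ab dla e.
have dmb : kgdeg mu = kgdeg be.
  apply: (@rowN_addrI _ _ _ (kgdeg lam)).
  by rewrite -kgdeg_comp // e kgdeg_comp // dla.
have [x [_ U]] := kg_factorisation (kgdeg_comp lm).
have e1 := U (lam, mu); have e2 := U (al, be).
by have [] : (lam, mu) = (al, be) by rewrite -e1 ?e2.
Qed.

Lemma kg_deg0 lam : kgdeg lam = 0 -> lam = kgid L (kgrng lam).
Proof.
move=> d0; have e : kgcomp (kgid L (kgrng lam)) lam = kgcomp lam (kgid L (kgsrc lam)).
  by rewrite kgcomp1l kgcomp1r.
have [//|||-> _//] := kg_cancel _ _ _ e; rewrite ?kgsrc_id ?kgrng_id //.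
by rewrite d0 kgdeg_id.
Qed.

Definition paths_of_degree n : {fset L} := fset_set [set lam : L | kgdeg lam = n].

End KGraphFactorisation.

Section PathsOfDegree.
Variables (k : nat) (V : finType) (L : kgraph k V).
Hypothesis L_row_finite : row_finite L.
Implicit Types (lam : L) (n : 'rV[nat]_k).

Lemma mem_paths_of_degree n lam : (lam \in paths_of_degree L n) = (kgdeg lam == n).
Proof.
rewrite in_fset_set; first by apply/idP/eqP; rewrite inE.
suff -> : [set lam : L | kgdeg lam = n] = \bigcup_(v in [set: V]) paths_from v n.
  by apply: bigcup_finite => // v _; apply: L_row_finite.
by apply/seteqP; split=> [mu dmu|mu [v _ [_ //]]]; exists (kgrng mu).
Qed.

Lemma sum_paths_from (A : nmodType) n (F : L -> A) :
  \sum_(v : V) \sum_(lam \in paths_from v n) F lam =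
  \sum_(lam <- paths_of_degree L n) F lam.
Proof.
rewrite (partition_big (@kgrng _ _ L) xpredT) //=; apply: eq_bigr => v _.
rewrite fsbig_finite; last exact: L_row_finite.
rewrite -[RHS]big_filter; apply: perm_big; apply: uniq_perm.
- exact: fset_uniq.
- by rewrite filter_uniq // fset_uniq.
move=> lam; rewrite mem_filter mem_paths_of_degree in_fset_set; last exact: L_row_finite.
by apply/idP/andP => [|[/eqP ? /eqP ?]]; rewrite inE => // -[-> ->].
Qed.

End PathsOfDegree.

(** * Kumjian-Pask families *)

(** A Kumjian-Pask family indexed by a k-graph with finitely many vertices, in a
    form without side conditions: a product of two generators that do not compose
    is 0, and (KP4), summed over all vertices, becomes the resolution of the
    identity kpf_one. *)
Record kp_family (k : nat) (V : finType) (L : kgraph k V) (A : pzRingType)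
    (s t : L -> A) : Prop := KPFamily {
  kpf_id : forall v, t (kgid L v) = s (kgid L v);
  kpf_ss : forall lam mu,
    s lam * s mu = if kgsrc lam == kgrng mu then s (kgcomp lam mu) else 0;
  kpf_tt : forall lam mu,
    t mu * t lam = if kgsrc lam == kgrng mu then t (kgcomp lam mu) else 0;
  kpf_ts : forall lam mu, kgdeg lam = kgdeg mu ->
    t lam * s mu = if lam == mu then s (kgid L (kgsrc lam)) else 0;
  kpf_one : forall n, \sum_(lam <- paths_of_degree L n) s lam * t lam = 1
}.

Section KPFamilyTheory.
Variables (k : nat) (V : finType) (L : kgraph k V) (A : pzRingType).
Variables (s t : L -> A).
Hypotheses (L_row_finite : row_finite L) (st : kp_family s t).
Implicit Types (lam mu nu al be : L) (v w : V).

Local Notation p v := (s (kgid L v)).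

Lemma kpf_ps v lam : p v * s lam = if v == kgrng lam then s lam else 0.
Proof. by rewrite (kpf_ss st) kgsrc_id; case: eqP => // ->; rewrite kgcomp1l. Qed.

Lemma kpf_pt v lam : p v * t lam = if kgsrc lam == v then t lam else 0.
Proof.
by rewrite -(kpf_id st) (kpf_tt st) kgrng_id; case: eqP => // <-; rewrite kgcomp1r.
Qed.

(** The degrees in s_al t_be can be raised at will, by inserting the resolution of
    the identity between the two factors. *)
Lemma kpf_expand al be n : s al * t be =
  \sum_(mu <- paths_of_degree L n | (kgsrc al == kgrng mu) && (kgsrc be == kgrng mu))
     s (kgcomp al mu) * t (kgcomp be mu).
Proof.
rewrite -[s al]mulr1 -(kpf_one st n) mulr_sumr mulr_suml [RHS]big_mkcond.
apply: eq_bigr => mu _.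
rewrite mulrA (kpf_ss st) -mulrA (kpf_tt st).
by do 2!case: eqP => _ /=; rewrite ?mul0r ?mulr0.
Qed.

(** Only the part of al and be up to a common degree matters. *)
Lemma kpf_ts_prefix al al' be be' : kgsrc al = kgrng al' -> kgsrc be = kgrng be' ->
  kgdeg al = kgdeg be -> al <> be -> t (kgcomp al al') * s (kgcomp be be') = 0.
Proof.
move=> ha hb d ne; have := kpf_tt st al al'; rewrite ha eqxx => <-.
have := kpf_ss st be be'; rewrite hb eqxx => <-.
rewrite mulrA -[_ * _ * s be]mulrA (kpf_ts st) //; case: eqP => // _.
by rewrite mulr0 mul0r.
Qed.

End KPFamilyTheory.

(** * Aperiodicity: isolating a coefficient *)

Lemma sum_undup_key (A : nmodType) (I J : eqType) (h : I -> J) (e : seq I)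
    (F : I -> A) :
  \sum_(x <- e) F x = \sum_(j <- undup (map h e)) \sum_(x <- e | h x == j) F x.
Proof.
rewrite (exchange_big_dep xpredT) //= [LHS]big_seq [RHS]big_seq.
apply: eq_bigr => x xe; rewrite big_mkcond (bigD1_seq (h x)) ?undup_uniq //=.
  by rewrite eqxx big1 ?addr0 // => j /negbTE; rewrite eq_sym => ->.
by rewrite mem_undup map_f.
Qed.

Section Reduction.
Variables (l : nat) (V : finType) (G : kgraph l V) (A : pzRingType).
Variables (s t : G -> A).
Hypotheses (G_row_finite : row_finite G) (st : kp_family s t).
Variables (C : comPzRingType) (io : {rmorphism C -> A}).
Hypothesis io_central : forall c a, io c * a = a * io c.
Implicit Types (lam mu nu al be : G) (n m : 'rV[nat]_l).

Local Notation p v := (s (kgid G v)).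

(** Fixing the degree of be makes the t_be orthogonal: t_be s_be' = 0 for distinct
    be and be', so a term can be singled out by multiplication on the right. *)
Definition kpf_span n (a : A) : Prop := exists e : seq (C * (G * G)),
  (forall x, x \in e -> kgsrc x.2.1 = kgsrc x.2.2 /\ kgdeg x.2.2 = n) /\
  a = \sum_(x <- e) io x.1 * (s x.2.1 * t x.2.2).

Lemma kpf_span0 n : kpf_span n 0.
Proof. by exists [::]; rewrite big_nil. Qed.

Lemma kpf_spanD n a b : kpf_span n a -> kpf_span n b -> kpf_span n (a + b).
Proof.
move=> [e [He ->]] [e' [He' ->]]; exists (e ++ e'); rewrite big_cat; split=> // x.
by rewrite mem_cat => /orP[/He|/He'].
Qed.

Lemma kpf_span_st n c al be : kgsrc al = kgsrc be -> kgdeg be = n ->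
  kpf_span n (io c * (s al * t be)).
Proof.
move=> ab dbe; exists [:: (c, (al, be))]; rewrite big_seq1; split=> // x.
by rewrite inE => /eqP ->.
Qed.

Lemma kpf_span_ind (P : A -> Prop) n : P 0 -> (forall a b, P a -> P b -> P (a + b)) ->
  (forall c al be, kgsrc al = kgsrc be -> kgdeg be = n -> P (io c * (s al * t be))) ->
  forall a, kpf_span n a -> P a.
Proof.
move=> P0 PD Pt _ [e [He ->]]; rewrite big_seq; elim/big_ind: _ => // x /He[].
exact: Pt.
Qed.

Lemma kpf_span_sum n (I : Type) (r : seq I) (Q : pred I) (F : I -> A) :
  (forall i, Q i -> kpf_span n (F i)) -> kpf_span n (\sum_(i <- r | Q i) F i).
Proof.
by move=> HF; elim/big_ind: _ => //; [exact: kpf_span0|exact: kpf_spanD].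
Qed.

Lemma kpf_span_addr n m a : kpf_span n a -> kpf_span (n + m) a.
Proof.
move: a; apply: kpf_span_ind; [exact: kpf_span0|exact: kpf_spanD|].
move=> c al be ab dbe; rewrite (kpf_expand st _ _ m) mulr_sumr big_seq_cond.
apply: kpf_span_sum => mu /and3P[dmu /eqP am /eqP bm].
apply: kpf_span_st; first by rewrite !kgsrc_comp.
by rewrite kgdeg_comp // dbe; move: dmu; rewrite mem_paths_of_degree // => /eqP ->.
Qed.

Lemma kpf_span_io n c a : kpf_span n a -> kpf_span n (io c * a).
Proof.
move: a; apply: kpf_span_ind; [rewrite mulr0; exact: kpf_span0| |].
  by move=> a b; rewrite mulrDr; exact: kpf_spanD.
by move=> c' al be *; rewrite mulrA -rmorphM; exact: kpf_span_st.
Qed.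

Lemma kpf_span_s n lam a : kpf_span n a -> kpf_span n (s lam * a).
Proof.
move: a; apply: kpf_span_ind; [rewrite mulr0; exact: kpf_span0| |].
  by move=> a b; rewrite mulrDr; exact: kpf_spanD.
move=> c al be ab dbe; rewrite mulrA -io_central -mulrA; apply: kpf_span_io.
rewrite mulrA (kpf_ss st); case: eqP => la; last by rewrite mul0r; exact: kpf_span0.
by rewrite -[_ * _]mul1r -(rmorph1 io); apply: kpf_span_st; rewrite ?kgsrc_comp.
Qed.

(** After raising degrees, lam is no longer than the path al of a term s_al t_be,
    and t_lam then either strips lam from al or kills the term. *)
Lemma kpf_span_t n lam a : kpf_span n a -> kpf_span (n + kgdeg lam) (t lam * a).
Proof.
move: a; apply: kpf_span_ind; [rewrite mulr0; exact: kpf_span0| |].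
  by move=> a b; rewrite mulrDr; exact: kpf_spanD.
move=> c al be ab dbe; rewrite mulrA -io_central -mulrA; apply: kpf_span_io.
rewrite (kpf_expand st _ _ (kgdeg lam)) mulr_sumr big_seq_cond.
apply: kpf_span_sum => mu /and3P[]; rewrite mem_paths_of_degree // => /eqP dmu.
move=> /eqP am /eqP bm.
have [|al1 [al2 [a12 E d1 d2]]] := @kg_factor _ _ _ (kgcomp al mu) (kgdeg lam) (kgdeg al).
  by rewrite kgdeg_comp // dmu addrC.
have sE := kpf_ss st al1 al2; rewrite a12 eqxx -E in sE; rewrite -sE.
rewrite !mulrA (kpf_ts st) //; case: eqP => [e|_]; last by rewrite !mul0r; exact: kpf_span0.
rewrite (kpf_ps st) e a12 eqxx -[_ * _]mul1r -(rmorph1 io); apply: kpf_span_st.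
  by rewrite -(kgsrc_comp a12) -E !kgsrc_comp.
by rewrite -e kgdeg_comp // dbe dmu.
Qed.

(** Aperiodicity: along a path x that is not eventually periodic, al x and be x
    differ as soon as the degrees of al and be do, and a long enough initial
    segment tau of x sees this; then t_(al tau) s_(be tau) = 0. *)
Lemma separating_path v (e : seq (G * G)) : aperiodic G ->
  (forall x, x \in e -> [/\ kgsrc x.1 = v, kgsrc x.2 = v & kgdeg x.1 <> kgdeg x.2]) ->
  exists2 tau, kgrng tau = v &
    forall x, x \in e -> t (kgcomp x.1 tau) * s (kgcomp x.2 tau) = 0.
Proof.
move=> /(_ v)[x [x0 x_aper]] He.
have xv n : kgrng (x 0 n) = v.
  rewrite -x0 /ip_vertex -(ip_composable x (lev_refl 0) (lev0 n)).
  by rewrite (ip_id x 0) kgsrc_id kgrng_id.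
suff [n Hn] : exists n, forall n', lev n n' -> forall y, y \in e ->
    t (kgcomp y.1 (x 0 n')) * s (kgcomp y.2 (x 0 n')) = 0.
  by exists (x 0 n) => //; apply: Hn; exact: lev_refl.
elim: e He => [|[al be] e IH] He; first by exists 0.
have [y ye|n Hn] := IH; first by apply: He; rewrite inE ye orbT.
have [/= sal sbe dab] := He (al, be) (mem_head _ _).
have /existsNP[p /existsNP[q /not_implyP[pq ne]]] := x_aper _ _ dab.
exists (n + (q + kgdeg al + kgdeg be)) => n' Hn' y; 
rewrite inE => /orP[/eqP -> /=|ye]; last first.
  by apply: Hn => //; apply: lev_trans Hn'; exact: lev_addr.
set da := kgdeg al in ne Hn'; set db := kgdeg be in ne Hn'.
have q' : lev (q + da + db) n' by apply: lev_trans Hn'; rewrite [n + _]addrC lev_addr.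
have qa : lev (q + da) n' by apply: lev_trans q'; exact: lev_addr.
have qb : lev (q + db) n' by apply: lev_trans q'; rewrite addrAC lev_addr.
have pqD m : lev (p + m) (q + m).
  by have /levP[r <-] := pq; rewrite addrAC lev_addr.
have dx m : kgdeg (x 0 m) = m by have := ip_deg x (lev0 m); rewrite add0r.
rewrite {1}(ip_comp x (lev0 _) qb) (ip_comp x (lev0 _) qa).
have cal m : kgsrc al = kgrng (x 0 m) by rewrite xv.
have cbe m : kgsrc be = kgrng (x 0 m) by rewrite xv.
have cx m m' (H : lev m m') : kgsrc (x 0 m) = kgrng (x m m').
  exact: ip_composable (lev0 _) H.
have [ca cb] := (cx _ _ qa, cx _ _ qb).
rewrite !kgcompA //; apply: (kpf_ts_prefix st); rewrite ?kgsrc_comp //.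
  by rewrite !kgdeg_comp // !dx addrCA [RHS]addrCA [da + db]addrC.
rewrite (ip_comp x (lev0 _) (pqD db)) (ip_comp x (lev0 _) (pqD da)).
have [ca' cb'] := (cx _ _ (pqD da), cx _ _ (pqD db)).
rewrite !kgcompA // => E; apply: ne.
have [] // := kg_cancel _ _ _ E; rewrite ?kgsrc_comp //.
by rewrite !kgdeg_comp // !dx addrCA [RHS]addrCA [da + db]addrC.
Qed.

(** The Cuntz-Krieger uniqueness argument: every coefficient c of a can be
    isolated as t_mu a s_nu = c p_v, by first compressing to the corner of the
    term at hand and then killing the surviving terms of other degrees with
    the previous lemma. *)
Lemma coefficients_isolated n a (J : set C) : aperiodic G -> kpf_span n a ->
  (forall mu nu c v, t mu * a * s nu = io c * p v -> J c) ->
  mulspan setT (io @` J) a.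
Proof.
move=> G_aper [e [He ae]] HJ.
pose c (j : G * G) := \sum_(x <- e | x.2 == j) x.1.
pose keys := undup (map snd e).
have aE : a = \sum_(j <- keys) io (c j) * (s j.1 * t j.2).
  rewrite ae (sum_undup_key snd); apply: eq_bigr => j _.
  rewrite rmorph_sum mulr_suml; apply: eq_bigr => x /eqP -> //.
have keysP j : j \in keys -> kgsrc j.1 = kgsrc j.2 /\ kgdeg j.2 = n.
  by rewrite mem_undup => /mapP[x /He ? ->].
suff Jc j : j \in keys -> J (c j).
  rewrite aE big_seq; elim/big_ind: _; [exact: mulspan0|exact: mulspanD|].
  by move=> j jk; rewrite io_central; apply: mulspan_mul => //; exists (c j); first exact: Jc.
move=> jk; have [sj dj] := keysP j jk.
(* The terms i that survive compression by t_(j.1) and s_(j.2) but have another degree. *)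
pose far := [seq (j.1, i.1) | i <- keys & (kgsrc i.1 == kgsrc j.1) && (kgdeg j.1 != kgdeg i.1)].
have [//|x /mapP[i]|tau rtau Htau] := @separating_path (kgsrc j.1) far.
  by rewrite mem_filter => /andP[/andP[/eqP si /eqP di] ik] -> /=.
apply: (HJ (kgcomp j.1 tau) (kgcomp j.2 tau) _ (kgsrc tau)).
have sst al be : kgsrc al = kgrng be -> s (kgcomp al be) = s al * s be.
  by move=> ab; rewrite (kpf_ss st) ab eqxx.
have termE i : i \in keys ->
    t (kgcomp j.1 tau) * (io (c i) * (s i.1 * t i.2)) * s (kgcomp j.2 tau) =
    if i == j then io (c j) * p (kgsrc tau) else 0.
  move=> ik; have [si di] := keysP i ik.
  rewrite mulrA -io_central -!mulrA sst -?sj // [t i.2 * _]mulrA.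
  rewrite (kpf_ts st) ?di ?dj //.
  have [i2|i2] := eqVneq i.2 j.2; last first.
    by rewrite mul0r !mulr0; case: eqP => // ij; rewrite ij eqxx in i2.
  rewrite (kpf_ps st) i2 -sj rtau eqxx -sst; last by rewrite si i2 -sj.
  have [ij|ij] := eqVneq i j.
    rewrite ij (kpf_ts st) // eqxx kgsrc_comp //.
  have [d1|d1] := eqVneq (kgdeg j.1) (kgdeg i.1).
    rewrite (kpf_ts_prefix st) ?mulr0 ?rtau // ?si ?i2 -?sj // => e1.
    by move: ij; rewrite [i]surjective_pairing -e1 i2 -surjective_pairing eqxx.
  rewrite (Htau (j.1, i.1)) ?mulr0 //; apply/mapP; exists i => //.
  by rewrite mem_filter ik d1 si i2 -sj eqxx.
rewrite {1}aE mulr_sumr mulr_suml big_seq (eq_bigr _ termE) -big_seq.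
rewrite (bigD1_seq j) ?undup_uniq //= eqxx big1 ?addr0 //.
by move=> i /negbTE ->.
Qed.

End Reduction.

(** * Cofinality: from a corner to the whole algebra *)

Section Segments.
Variables (l : nat) (V : countType) (G : kgraph l V).
Implicit Types (al be ga : G) (p q n : 'rV[nat]_l).

Definition segment al p q be : Prop := exists al' al'',
  [/\ kgsrc al' = kgrng be, kgsrc be = kgrng al'',
      al = kgcomp (kgcomp al' be) al'', kgdeg al' = p & p + kgdeg be = q].

Lemma segment_ex al p q : lev p q -> lev q (kgdeg al) -> exists be, segment al p q be.
Proof.
move=> /levP[m <-] /levP[n /esym/kg_factor[ab [c [abc -> dab dc]]]].
have [a [b [e E da db]]] := kg_factor dab.
exists b, a, c; split=> //; rewrite -?E ?da ?db //.
by rewrite -abc E kgsrc_comp.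
Qed.

Lemma segment_uniq al p q be be' : segment al p q be -> segment al p q be' -> be = be'.
Proof.
move=> [a [c [ab bc -> da db]]] [a' [c' [ab' bc' + da' db']]].
have dbb : kgdeg be = kgdeg be' by apply: (@rowN_addrI _ _ _ p); rewrite db db'.
move=> /kg_cancel[]; rewrite ?kgsrc_comp ?kgdeg_comp ?da ?da' ?dbb //.
by move=> /kg_cancel[]; rewrite ?da ?da'.
Qed.

Lemma segment_extend al ga p q be : kgsrc al = kgrng ga ->
  segment al p q be -> segment (kgcomp al ga) p q be.
Proof.
move=> + [a [c [ab bc E da db]]].
have abc : kgsrc (kgcomp a be) = kgrng c by rewrite kgsrc_comp.
rewrite E kgsrc_comp // => cg.
by exists a, (kgcomp c ga); rewrite kgrng_comp // kgcompA.
Qed.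

Lemma segment_cat al p q n be ga de : segment al p q be -> segment al q n ga ->
  segment al p n de -> kgsrc be = kgrng ga /\ de = kgcomp be ga.
Proof.
move=> [a [c [ab bc E da db]]] [a' [c' [ab' bc' E' da' db']]] Hde.
have := etrans (esym E) E'; rewrite -(kgcompA ab' bc') => /kg_cancel[].
- by rewrite kgsrc_comp.
- by rewrite kgrng_comp.
- by rewrite kgdeg_comp // da db da'.
move=> ea ec; have bg : kgsrc be = kgrng ga by rewrite -ab' -ea kgsrc_comp.
split=> //; apply: segment_uniq Hde _; exists a, c'.
rewrite kgsrc_comp // kgrng_comp // kgdeg_comp // addrA db; split=> //.
by rewrite kgcompA // ea.
Qed.

Lemma segment_end al : segment al (kgdeg al) (kgdeg al) (kgid G (kgsrc al)).
Proof.
exists al, (kgid G (kgsrc al)).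
by rewrite kgrng_id kgsrc_id !kgcomp1r kgdeg_id addr0.
Qed.

(** An increasing sequence of paths whose degrees exhaust N^l converges to an
    infinite path. *)
Lemma infinite_path_limit (y : nat -> G) :
  (forall N, exists2 ga, kgsrc (y N) = kgrng ga & y N.+1 = kgcomp (y N) ga) ->
  (forall q, exists N, lev q (kgdeg (y N))) ->
  exists x : infinite_path G, forall N p q be, segment (y N) p q be -> x p q = be.
Proof.
move=> y_inc y_deg.
have segW N M p q be : segment (y N) p q be -> segment (y (N + M)%N) p q be.
  move=> H; elim: M => [|M IH]; rewrite ?addn0 // addnS.
  by have [ga cg ->] := y_inc (N + M)%N; apply: segment_extend.
have segU N M p q be be' : segment (y N) p q be -> segment (y M) p q be' -> be = be'.
  move=> /(segW _ M) H /(segW _ N); rewrite addnC; exact: segment_uniq.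
have /boolp.choice[X HX] (z : 'rV[nat]_l * 'rV[nat]_l) :
    exists be, lev z.1 z.2 -> exists N, segment (y N) z.1 z.2 be.
  have [pq|] := boolP (lev z.1 z.2); last by exists (y 0%N).
  by have [N HN] := y_deg z.2; have [be] := segment_ex pq HN; exists be => _; exists N.
pose x p q := X (p, q).
have xP p q : lev p q -> exists N, segment (y N) p q (x p q) by apply: (HX (p, q)).
have xE N p q be : segment (y N) p q be -> x p q = be.
  move=> H; have pq : lev p q by have [? [? [_ _ _ _ <-]]] := H; exact: lev_addr.
  by have [M HM] := xP _ _ pq; apply: segU HM H.
have xcat p q n : lev p q -> lev q n -> kgsrc (x p q) = kgrng (x q n) /\
    x p n = kgcomp (x p q) (x q n).
  move=> pq qn; have pn := lev_trans pq qn.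
  have [[N H1] [M H2] [K H3]] := And3 (xP _ _ pq) (xP _ _ qn) (xP _ _ pn).
  apply: (@segment_cat (y (N + M + K)%N) p q n).
  - by rewrite -addnA; exact: segW.
  - by rewrite [(N + M)%N]addnC -addnA; exact: segW.
  - by rewrite addnC; exact: segW.
have xdeg p q : lev p q -> p + kgdeg (x p q) = q.
  by move=> /xP[N [? [? []]]].
have xid p : x p p = kgid G (kgrng (x p p)).
  apply: kg_deg0; apply: (@rowN_addrI _ _ _ p); rewrite xdeg ?addr0 //.
  exact: lev_refl.
exists (@InfinitePath _ _ G x xdeg xid (fun p q n H H' => (xcat p q n H H').1)
  (fun p q n H H' => (xcat p q n H H').2)) => N p q be; exact: xE.
Qed.

End Segments.

Section Cofinality.
Variables (l : nat) (V : finType) (G : kgraph l V) (A : pzRingType).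
Variables (s t : G -> A).
Hypotheses (G_row_finite : row_finite G) (G_no_sources : no_sources G).
Hypotheses (G_cofinal : cofinal G) (st : kp_family s t).
Variable I : set A.
Hypothesis idI : two_sided_ideal I.
Variable z : A.
Hypothesis z_central : forall a, z * a = a * z.
Implicit Types (lam : G) (v w : V).

Local Notation p v := (s (kgid G v)).

Let E v := I (z * p v).

Let E_hereditary lam : E (kgrng lam) -> E (kgsrc lam).
Proof.
have [_ _ IM] := idI => Er.
have := kpf_ts st (erefl (kgdeg lam)); rewrite eqxx /E => <-.
have -> : z * (t lam * s lam) = t lam * (z * p (kgrng lam)) * s lam.
  by rewrite -!mulrA (kpf_ps st) eqxx mulrA z_central -mulrA.
by apply: (IM _ _ _).2; apply: (IM _ _ _).1.
Qed.

Let E_saturated v n : (forall lam, kgrng lam = v -> kgdeg lam = n -> E (kgsrc lam)) -> E v.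
Proof.
have [I0 ID IM] := idI => Es.
rewrite /E -[p v]mulr1 -(kpf_one st n) !mulr_sumr big_seq.
elim/big_ind: _ => // lam; rewrite mem_paths_of_degree // => /eqP dlam.
rewrite [p v * _]mulrA (kpf_ps st); case: eqP => [vr|]; last by rewrite mul0r mulr0.
have -> : z * (s lam * t lam) = s lam * (z * p (kgsrc lam)) * t lam.
  rewrite -!mulrA (kpf_pt st) eqxx [RHS]mulrA -z_central mulrA //.
by apply: (IM _ _ _).2; apply: (IM _ _ _).1; apply: Es.
Qed.

(** The vertices v with z p_v in I form a hereditary and saturated set.  A vertex
    outside of it starts an infinite path avoiding the set, which cofinality
    forbids. *)
Lemma cofinal_corner_full v : I (z * p v) -> I z.
Proof.
move=> Ev; have [I0 ID IM] := idI.
suff Eall w : E w.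
  rewrite -[z]mulr1 -(kpf_one st 0) mulr_sumr; elim/big_ind: _ => // lam _.
  have := kpf_ps st (kgrng lam) lam; rewrite eqxx => <-.
  by rewrite !mulrA; do 2!apply: (IM _ _ _).2; apply: Eall.
apply: contrapT => nEw.
(* F u is a path of degree (1, .., 1) from u that stays outside of the set if u
   is outside; it exists because the set is saturated. *)
pose one : 'rV[nat]_l := const_mx 1%N.
have /boolp.choice[F HF] (u : V) : exists lam,
    [/\ kgrng lam = u, kgdeg lam = one & ~ E u -> ~ E (kgsrc lam)].
  have [Eu|nEu] := pselect (E u); first by have [lam []] := G_no_sources u one; exists lam.
  apply: contrapT => H; apply: nEu; apply: (@E_saturated _ one) => lam rl dl.
  by apply: contrapT => nEs; apply: H; exists lam.
pose fix y N : G := if N is N'.+1 then kgcomp (y N') (F (kgsrc (y N'))) else kgid G w.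
have rF u : kgrng (F u) = u by have [] := HF u.
have nEy N : ~ E (kgsrc (y N)).
  elim: N => [|N IH] /=; first by rewrite kgsrc_id.
  by rewrite kgsrc_comp ?rF //; have [_ _] := HF (kgsrc (y N)); apply.
have dy N : kgdeg (y N) = one *+ N.
  elim: N => [|N IH] /=; first by rewrite kgdeg_id.
  by rewrite kgdeg_comp ?rF // IH mulrSr; have [_ -> _] := HF (kgsrc (y N)).
have y_deg q : exists N, lev q (kgdeg (y N)).
  exists (\sum_j q ord0 j)%N; apply/forallP => j.
  rewrite dy; have -> n : (one *+ n) ord0 j = n.
    by elim: n => [|n IH]; rewrite ?mulr0n ?mulrS mxE // IH mxE.
  by rewrite (bigD1 j) //= leq_addr.
have [|x Hx] := infinite_path_limit _ y_deg.
  by move=> N; exists (F (kgsrc (y N))); rewrite ?rF.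
have [n [lam [rl sl]]] := G_cofinal v x.
have [N HN] := y_deg n; apply: (nEy N).
have xN : kgsrc (x n (kgdeg (y N))) = kgsrc (y N).
  rewrite (ip_composable x HN (lev_refl _)).
  by rewrite (Hx _ _ _ _ (segment_end (y N))) kgrng_id.
rewrite -xN; apply: E_hereditary; rewrite -(ip_composable x (lev_refl n) HN).
rewrite (ip_id x n) kgsrc_id -/(ip_vertex x n) -sl.
by apply: E_hereditary; rewrite rl.
Qed.

End Cofinality.

(** * The generators of the Kumjian-Pask algebra form a family *)

Section KPIsFamily.
Variables (R : comPzRingType) (k : nat) (V : finType) (L : kgraph k V).
Hypothesis L_row_finite : row_finite L.
Local Notation A := (KP R L).
Local Open Scope quotient_scope.

Lemma KP_scalerAl (a : R) (x y : A) : a *: (x * y) = (a *: x) * y.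
Proof. exact: kp_scalerAl. Qed.
Lemma KP_scalerAr (a : R) (x y : A) : a *: (x * y) = x * (a *: y).
Proof. exact: kp_scalerAr. Qed.

Lemma kp_s_vertex v : kp_s R (kgid L v) = kp_p R L v.
Proof. by apply/kp_piP; exact: kp_s_id. Qed.

Let mulE (x y : kp_term R L) : \pi_A x * \pi_A y = \pi_A (KPmul x y).
Proof. exact: kp_mulE. Qed.

Let p_orth v w : v <> w -> kp_p R L v * kp_p R L w = 0.
Proof. by move=> vw; rewrite mulE; apply/kp_piP/kp1_orth. Qed.

(** (KP4), extended to n = 0, where the only path from v is v itself. *)
Lemma kp_p_sum v n : kp_p R L v =
  \sum_(lam \in paths_from v n) kp_s R (lam : L) * kp_g R lam.
Proof.
rewrite fsbig_finite; last exact: L_row_finite.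
have [->|n0] := eqVneq n 0.
  have -> : paths_from v 0 = [set kgid L v].
    apply/seteqP; split=> lam /=; first by case=> <- d0; apply: kg_deg0.
    by move=> ->; rewrite /paths_from /= kgrng_id kgdeg_id.
  rewrite fset_set1 big_seq_fset1 mulE; apply/kp_piP.
  apply: (kp_trans (y := KPmul (KPv R L v) (KPv R L v))).
    by apply: kp_sym; apply: kp1_idem.
  by apply: kp_mul_congr; apply: kp_sym; [exact: kp_s_id|exact: kp_g_id].
set e := fset_set _.
have -> : \sum_(lam <- e) kp_s R (lam : L) * kp_g R lam =
    \pi_A (\big[@KPadd R k V L/KPzero R L]_(lam <- e) KPmul (KPs R lam) (KPg R lam)).
  elim: (enum_fset e) => [|lam r IH]; first by rewrite !big_nil.
  by rewrite !big_cons IH mulE; exact: kp_addE.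
apply/kp_piP; apply: (@kp4 R k V L v n); [exact/eqP|exact: fset_uniq|move=> lam].
by rewrite in_fset_set ?inE //; exact: L_row_finite.
Qed.

Lemma KP_kp_family : kp_family (@kp_s R k V L) (@kp_g R k V L).
Proof.
have ss lam : kp_s R (lam : L) = kp_s R lam * kp_p R L (kgsrc lam).
  by apply/esym; rewrite mulE; apply/kp_piP/kp2_ss.
have rs lam : kp_s R (lam : L) = kp_p R L (kgrng lam) * kp_s R lam.
  by apply/esym; rewrite mulE; apply/kp_piP/kp2_rs.
have sg lam : kp_g R (lam : L) = kp_p R L (kgsrc lam) * kp_g R lam.
  by apply/esym; rewrite mulE; apply/kp_piP/kp2_sg.
have rg lam : kp_g R (lam : L) = kp_g R lam * kp_p R L (kgrng lam).
  by apply/esym; rewrite mulE; apply/kp_piP/kp2_rg.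
split=> [v|lam mu|lam mu|lam mu d|n].
- by rewrite kp_s_vertex; apply/kp_piP/kp_g_id.
- case: eqP => [lm|nlm]; first by rewrite mulE; apply/kp_piP/kp2_s.
  by rewrite (ss lam) (rs mu) mulrA -[_ * _ * kp_p _ _ _]mulrA p_orth // mulr0 mul0r.
- case: eqP => [lm|nlm]; first by rewrite mulE; apply/kp_piP/kp2_g.
  rewrite (rg mu) (sg lam) mulrA -[_ * _ * kp_p _ _ _]mulrA p_orth ?mulr0 ?mul0r //.
  exact: nesym.
- case: eqP => [<-|ne]; first by rewrite mulE kp_s_vertex; apply/kp_piP/kp3_eq.
  by rewrite mulE; apply/kp_piP/kp3_neq.
- rewrite -sum_paths_from //; apply: eq_bigr => v _.
  by rewrite -(kp_p_sum v n).
Qed.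

End KPIsFamily.

(** Multiply t_lam x on the right by the resolution of the identity in degree
    d(lam): the elements x s_mu = s_mu x can be swapped, and only mu = lam
    survives. *)
Lemma kpf_commute_t (k : nat) (V : finType) (L : kgraph k V) (A : pzRingType)
    (s t : L -> A) (x : A) : row_finite L -> kp_family s t ->
  (forall lam, x * s lam = s lam * x) -> forall lam, x * t lam = t lam * x.
Proof.
move=> rfL st xs lam; rewrite -[RHS]mulr1 -(kpf_one st (kgdeg lam)) mulr_sumr.
rewrite (bigD1_seq lam) ?fset_uniq //=; last by rewrite mem_paths_of_degree.
rewrite big_seq_cond big1 ?addr0 => [|mu /andP[]].
  rewrite mulrA -[_ * s lam]mulrA xs mulrA (kpf_ts st) // eqxx -xs -mulrA.
  by rewrite (kpf_pt st) eqxx.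
rewrite mem_paths_of_degree // => /eqP dmu ml.
rewrite mulrA -[_ * s mu]mulrA xs mulrA (kpf_ts st) // eq_sym (negbTE ml).
by rewrite !mul0r.
Qed.

(** * The Kumjian-Pask algebra of a pullback *)

(** The generator e_j of N^l is irreducible, so if f m = e_j, then f maps some e_i
    to e_j; a section sends e_j to such an e_i. *)
Lemma additive_section (k l : nat) (f : {additive 'rV[nat]_k -> 'rV[nat]_l}) :
  (forall n, exists m, f m = n) ->
  exists h : {additive 'rV[nat]_l -> 'rV[nat]_k}, forall n, f (h n) = n.
Proof.
move=> f_surj; pose d m (j : 'I_m) : 'rV[nat]_m := delta_mx 0 j.
have sumd m (n : 'rV[nat]_m) : n = \sum_j d m j *+ n ord0 j.
  apply/rowP => j; rewrite summxE (bigD1 j) //= big1 => [|i ij].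
    have -> : (d m j *+ n ord0 j) ord0 j = (n ord0 j)%N.
      by elim: (n ord0 j) => [|x IH]; rewrite ?mulr0n ?mulrS mxE // IH mxE !eqxx.
    by rewrite /GRing.add /= addn0.
  elim: (n ord0 i) => [|x IH]; rewrite ?mulr0n ?mulrS mxE // IH mxE eqxx eq_sym.
  by rewrite (negbTE ij).
have /boolp.choice[i fi] (j : 'I_l) : exists i, f (d k i) = d l j.
  have [m fm] := f_surj (d l j).
  move: (fm); rewrite {1}[m]sumd raddf_sum => E.
  have fle i : (0 < m ord0 i)%N -> lev (f (d k i)) (d l j).
    move=> mi; apply/levP; rewrite -E (bigD1 i) //=.
    rewrite raddfMn -(prednK mi) mulrS -addrA; by eexists.
  have /hasP[i _ /andP[mi fij]] :
      has (fun i => (0 < m ord0 i)%N && (0 < f (d k i) ord0 j)%N) (enum 'I_k).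
    apply: contraT => /hasPn H.
    have : (d l j) ord0 j = 0%N.
      rewrite -E summxE big1 // => i _; have := H i; rewrite mem_enum => /(_ isT).
      rewrite negb_and -!leqNgt !leqn0 => /orP[/eqP ->|/eqP fij].
        by rewrite mulr0n raddf0 mxE.
      rewrite raddfMn; elim: (m ord0 i) => [|x IH]; rewrite ?mulr0n ?mulrS mxE // IH fij //.
    by rewrite mxE !eqxx.
  exists i; have /forallP lefd := fle i mi.
  apply/rowP => j'; have := lefd j'; rewrite !mxE eqxx /=.
  case: eqP => [->|_] /=; last by rewrite leqn0 => /eqP.
  by move=> le1; apply/eqP; rewrite eqn_leq le1.
pose h (n : 'rV[nat]_l) := \sum_j d k (i j) *+ n ord0 j.
have h_add : nmod_morphism h.
  split=> [|m n]; first by rewrite /h big1 // => j _; rewrite mxE.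
  by rewrite /h -big_split; apply: eq_bigr => j _; rewrite mxE mulrnDr.
exists (HB.pack_for {additive 'rV[nat]_l -> 'rV[nat]_k} h
  (GRing.isNmodMorphism.Build _ _ h h_add)).
move=> n; rewrite /= /h raddf_sum [RHS]sumd; apply: eq_bigr => j _.
by rewrite raddfMn fi.
Qed.

Section Pullback.
Variables (K : fieldType) (k l : nat) (V : finType).
Variables (f : {additive 'rV[nat]_k -> 'rV[nat]_l}) (G : kgraph l V).
Hypothesis G_row_finite : row_finite G.
Implicit Types (lam mu nu rho : G) (a b c n m : 'rV[nat]_k).

Local Notation P := (pullback f G).
Local Notation A := (KP K P).
Local Notation H := (ker_fbar f).
Local Notation C := (grpalg K H).

Lemma pullback_row_finite : row_finite P.
Proof.
move=> v n; apply: (@sub_finite_set _ _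
  ((val : P -> G * 'rV[nat]_k) @^-1` (paths_from v (f n) `*` [set n]))).
  move=> x [rx dx]; split=> //=; split=> //.
  by rewrite (eqP (valP x)); congr (f _); exact: dx.
apply: finite_preimage; last by apply: finite_setX => //; exact: finite_set1.
by move=> x y _ _; exact: val_inj.
Qed.

Local Notation S := (@pb_s K k l V f G).
Local Notation T := (@pb_g K k l V f G).
Local Notation p v := (kp_p K P v).

Let kpF := KP_kp_family K pullback_row_finite.

Lemma pb_lift lam n : kgdeg lam = f n -> exists x : P,
  [/\ val x = (lam, n), S lam n = kp_s K x & T lam n = kp_g K x].
Proof.
move=> dl; have Px : pb_pred f (lam, n) by apply/eqP.
exists (exist (fun y => pb_pred f y) _ Px); rewrite /pb_s /pb_g insubT /=.
by split=> //; congr (_ _); apply: val_inj.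
Qed.

Lemma pb_val (x : P) : kp_s K x = S (val x).1 (val x).2 /\ kp_g K x = T (val x).1 (val x).2.
Proof.
have [y [yE -> ->]] := pb_lift (eqP (valP x)).
by have -> : y = x by apply: val_inj; rewrite yE -surjective_pairing.
Qed.

Lemma pb_vertex v : S (kgid G v) 0 = p v /\ T (kgid G v) 0 = p v.
Proof.
have [|x [xE -> ->]] := @pb_lift (kgid G v) 0; first by rewrite kgdeg_id raddf0.
have -> : x = kgid P v by apply: val_inj.
by rewrite (kpf_id kpF) kp_s_vertex.
Qed.

Lemma pb_ss lam mu n m : kgdeg lam = f n -> kgdeg mu = f m ->
  S lam n * S mu m = if kgsrc lam == kgrng mu then S (kgcomp lam mu) (n + m) else 0.
Proof.
move=> dl dm; have [x [xE -> _]] := pb_lift dl; have [y [yE -> _]] := pb_lift dm.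
have sx : kgsrc x = kgsrc lam by rewrite /= /pb_src xE.
have ry : kgrng y = kgrng mu by rewrite /= /pb_rng yE.
rewrite (kpf_ss kpF) sx ry; case: eqP => // lm.
have [|z [zE -> _]] := @pb_lift (kgcomp lam mu) (n + m).
  by rewrite kgdeg_comp // dl dm raddfD.
by congr kp_s; apply: val_inj; rewrite zE /= val_pb_comp ?xE ?yE // /pb_src /pb_rng xE yE.
Qed.

Lemma pb_tt lam mu n m : kgdeg lam = f n -> kgdeg mu = f m ->
  T mu m * T lam n = if kgsrc lam == kgrng mu then T (kgcomp lam mu) (n + m) else 0.
Proof.
move=> dl dm; have [x [xE _ ->]] := pb_lift dl; have [y [yE _ ->]] := pb_lift dm.
have sx : kgsrc x = kgsrc lam by rewrite /= /pb_src xE.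
have ry : kgrng y = kgrng mu by rewrite /= /pb_rng yE.
rewrite (kpf_tt kpF) sx ry; case: eqP => // lm.
have [|z [zE _ ->]] := @pb_lift (kgcomp lam mu) (n + m).
  by rewrite kgdeg_comp // dl dm raddfD.
by congr kp_g; apply: val_inj; rewrite zE /= val_pb_comp ?xE ?yE // /pb_src /pb_rng xE yE.
Qed.

Lemma pb_ts lam mu n : kgdeg lam = f n -> kgdeg mu = f n ->
  T lam n * S mu n = if lam == mu then p (kgsrc lam) else 0.
Proof.
move=> dl dm; have [x [xE _ ->]] := pb_lift dl; have [y [yE -> _]] := pb_lift dm.
have sx : kgsrc x = kgsrc lam by rewrite /= /pb_src xE.
rewrite (kpf_ts kpF); last by rewrite /= /pb_deg xE yE.
have -> : (x == y) = (lam == mu) by rewrite -val_eqE xE yE xpair_eqE eqxx andbT.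
by rewrite sx kp_s_vertex.
Qed.

Lemma pb_one n : \sum_(lam <- paths_of_degree G (f n)) S lam n * T lam n = 1.
Proof.
rewrite -(kpf_one kpF n).
have memP (x : P) : (x \in paths_of_degree P n) = ((val x).2 == n).
  by rewrite mem_paths_of_degree //; exact: pullback_row_finite.
transitivity (\sum_(lam <- [seq (val x).1 | x <- enum_fset (paths_of_degree P n)])
  S lam n * T lam n).
  apply: perm_big; apply: uniq_perm; first exact: fset_uniq.
    rewrite map_inj_in_uniq ?fset_uniq // => x y; rewrite !memP => /eqP xn /eqP yn e.
    by apply: val_inj; rewrite [LHS]surjective_pairing [RHS]surjective_pairing e xn yn.
  move=> lam; rewrite mem_paths_of_degree //; apply/eqP/mapP => [dl|[x]].
    by have [x [xE _ _]] := pb_lift dl; exists x; rewrite ?memP xE.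
  by rewrite memP => /eqP <- ->; exact: (eqP (valP x)).
rewrite big_map big_seq [RHS]big_seq; apply: eq_bigr => x.
rewrite -[x \in _]/(x \in paths_of_degree P n) memP.
by move=> /eqP <-; have [-> ->] := pb_val x.
Qed.

(** For f a = f b, multiplication by transfer a b turns the generators of degree b
    into those of degree a.  These are the central units U_h, with h = a - b;
    keeping a and b apart makes their product telescope. *)
Definition transfer a b : A := \sum_(lam <- paths_of_degree G (f a)) S lam a * T lam b.

Lemma transfer_s a b nu : f a = f b -> kgdeg nu = f b -> transfer a b * S nu b = S nu a.
Proof.
move=> ab dn; rewrite /transfer mulr_suml (bigD1_seq nu) ?fset_uniq //=; last first.
  by rewrite mem_paths_of_degree // ab dn.
rewrite big_seq_cond big1 ?addr0 => [|mu /andP[]].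
  rewrite -mulrA pb_ts // eqxx; have [<- _] := pb_vertex (kgsrc nu).
  by rewrite pb_ss ?kgrng_id ?eqxx ?kgcomp1r ?addr0 ?ab // kgdeg_id raddf0.
rewrite mem_paths_of_degree // ab => /eqP dmu /negbTE mn.
by rewrite -mulrA pb_ts // mn mulr0.
Qed.

Lemma t_transfer a b nu : f a = f b -> kgdeg nu = f a -> T nu a * transfer a b = T nu b.
Proof.
move=> ab dn; rewrite /transfer mulr_sumr (bigD1_seq nu) ?fset_uniq //=; last first.
  by rewrite mem_paths_of_degree // dn.
rewrite big_seq_cond big1 ?addr0 => [|mu /andP[]].
  rewrite mulrA pb_ts // eqxx; have [_ <-] := pb_vertex (kgsrc nu).
  by rewrite pb_tt ?kgrng_id ?eqxx ?kgcomp1r ?addr0 -?ab // kgdeg_id raddf0.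
rewrite mem_paths_of_degree // => /eqP dmu /negbTE mn.
by rewrite mulrA pb_ts // eq_sym mn mul0r.
Qed.

(** By the resolution of the identity, x is the sum of the x s_nu t_nu with nu of
    one degree, so it is determined by the products x s_nu. *)
Lemma transfer_unique (x : A) a b : f a = f b ->
  (forall nu, kgdeg nu = f b -> x * S nu b = S nu a) -> x = transfer a b.
Proof.
move=> ab xs; rewrite -[x]mulr1 -(pb_one b) /transfer ab mulr_sumr big_seq [RHS]big_seq.
by apply: eq_bigr => nu; rewrite mem_paths_of_degree // => /eqP dn; rewrite mulrA xs.
Qed.

Lemma transfer_id a : transfer a a = 1. Proof. exact: pb_one. Qed.

Lemma transfer_M a b c : f a = f b -> f b = f c -> transfer a b * transfer b c = transfer a c.
Proof.
move=> ab bc; apply: transfer_unique => [|nu dn]; first by rewrite ab.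
by rewrite -mulrA (transfer_s bc dn) transfer_s // bc.
Qed.

Lemma transfer_addr a b c : f a = f b -> transfer (a + c) (b + c) = transfer a b.
Proof.
move=> ab; apply/esym/transfer_unique => [|rho]; first by rewrite !raddfD ab.
rewrite raddfD => /kg_factor[lam [mu [lm -> dl dm]]].
have := pb_ss dl dm; rewrite lm eqxx => <-.
by rewrite mulrA transfer_s // pb_ss ?ab // lm eqxx.
Qed.

Lemma transfer_eq a b a' b' : f a = f b -> f a' = f b' -> a + b' = a' + b ->
  transfer a b = transfer a' b'.
Proof.
move=> ab ab' e; rewrite -(transfer_addr b' ab) e -(transfer_addr b ab').
by rewrite [b' + b]addrC.
Qed.

(** Split s_(nu, n) through the paths mu of degree f b: on s_(nu mu, n + b) the
    element transfer a b = transfer (n + a) (n + b) acts by changing the degree. *)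
Lemma transfer_commute_s a b nu n : f a = f b -> kgdeg nu = f n ->
  transfer a b * S nu n = S nu n * transfer a b.
Proof.
move=> ab dn; rewrite -[LHS]mulr1 -(pb_one b) /transfer ab mulr_sumr mulr_sumr.
rewrite big_seq [RHS]big_seq.
apply: eq_bigr => mu; rewrite mem_paths_of_degree // => /eqP dm.
rewrite !mulrA -ab -/(transfer a b) -[_ * S nu n * S mu b]mulrA !pb_ss ?ab //.
case: eqP => nm; last by rewrite mulr0 !mul0r.
congr (_ * _); rewrite -(transfer_addr n ab) ![n + _]addrC transfer_s ?raddfD ?ab //.
by rewrite kgdeg_comp // dn dm addrC.
Qed.

Lemma transfer_central a b x : f a = f b -> transfer a b * x = x * transfer a b.
Proof.
move=> ab.
have Ws (y : P) : transfer a b * kp_s K y = kp_s K y * transfer a b.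
  by have [-> _] := pb_val y; apply: transfer_commute_s => //; exact: (eqP (valP y)).
move: x; apply: KP_ind => //.
- by move=> v; rewrite -kp_s_vertex.
- exact: (kpf_commute_t pullback_row_finite kpF).
- by rewrite mulr0 mul0r.
- by move=> x y xW yW; rewrite mulrDr mulrDl xW yW.
- by move=> x xW; rewrite mulrN mulNr xW.
- by move=> z x xW; rewrite -KP_scalerAr -KP_scalerAl xW.
- by move=> x y xW yW; rewrite -[kp_mul x y]/(x * y) mulrA xW -mulrA yW mulrA.
Qed.

Lemma ker_f (h : H) : f (posv h) = f (negv h).
Proof.
by apply: intv_inj; apply/eqP; rewrite -subr_eq0; have := valP h.
Qed.

Lemma Uh_posneg (h : H) : Uh K G h = transfer (posv h) (negv h).
Proof. by rewrite /Uh sum_paths_from. Qed.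

Lemma Uh_transfer (h : H) a b : f a = f b -> ker_val h = intv a - intv b ->
  Uh K G h = transfer a b.
Proof.
move=> ab hE; rewrite Uh_posneg; apply: transfer_eq => //; first exact: ker_f.
apply: intv_inj; rewrite !intvD.
have -> : intv (posv h) = intv a - intv b + intv (negv h).
  by rewrite -hE {2}[ker_val h]posv_negv subrK.
by rewrite addrAC subrK.
Qed.

Local Notation U h := (Uh K G (h : H)).
Local Notation iota := (@iota_C K k l V f G).

Let intv0 : intv (0 : 'rV[nat]_k) = 0.
Proof. by apply/matrixP => i j; rewrite !mxE. Qed.

Lemma Uh0 : U 0 = 1.
Proof. by rewrite (@Uh_transfer _ 0 0) ?transfer_id // intv0 subr0. Qed.

Lemma UhD (g h : H) : U (g + h) = U g * U h.
Proof.
have [fg fh] := (ker_f g, ker_f h).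
rewrite (Uh_posneg g) (Uh_posneg h) -(transfer_addr (posv h) fg) -(transfer_addr (negv g) fh).
rewrite ![posv h + _]addrC [negv h + _]addrC ![_ + posv h]addrC.
rewrite transfer_M ?raddfD ?fg ?fh //; last by rewrite addrC.
apply: Uh_transfer; first by rewrite !raddfD fg fh addrC.
by rewrite !intvD /= {1}[ker_val g]posv_negv {1}[ker_val h]posv_negv opprD addrACA
  [intv (posv g) + _]addrC.
Qed.

Lemma Uh_central (h : H) x : U h * x = x * U h.
Proof. by rewrite Uh_posneg // transfer_central // ker_f. Qed.

Lemma iota_CE (c : C) (d : {fset H}) : (msupp c `<=` d)%fset ->
  iota c = \sum_(h <- d) c@_h *: U h.
Proof.
move=> cd; rewrite /iota_C (big_fset_incl _ cd) // => h _ /mcoeff_outdom ->.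
by rewrite scale0r.
Qed.

Lemma iota_U (a : K) h : iota << a *g h >> = a *: U h.
Proof. by rewrite (iota_CE msuppU_le) big_seq_fset1 mcoeffUU. Qed.

Let iotaD : nmod_morphism iota.
Proof.
split=> [|c d]; first by rewrite /iota_C msupp0 big_seq_fset0.
rewrite (iota_CE (msuppD_le c d)) (iota_CE (fsubsetUl (msupp c) (msupp d))).
rewrite (iota_CE (fsubsetUr (msupp c) (msupp d))) -big_split.
by apply: eq_bigr => h _; rewrite mcoeffD scalerDl.
Qed.

Let iota_sum (I : Type) (r : seq I) (F : I -> C) :
  iota (\sum_(i <- r) F i) = \sum_(i <- r) iota (F i).
Proof. exact: (big_morph iota iotaD.2 iotaD.1). Qed.

Let iotaM : monoid_morphism iota.
Proof.
split=> [|c d]; first by rewrite -[1 in LHS]/(ga_u K 0) iota_U Uh0 scale1r.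
rewrite [c * d]/(ga_mul c d) /ga_mul iota_sum {2}/iota_C mulr_suml.
apply: eq_bigr => g _; rewrite iota_sum /iota_C mulr_sumr.
apply: eq_bigr => h _.
apply: etrans (iota_U _ _) _; by rewrite UhD -KP_scalerAl -KP_scalerAr scalerA.
Qed.

Lemma iota_central (c : C) x : iota c * x = x * iota c.
Proof.
rewrite /iota_C mulr_suml mulr_sumr; apply: eq_bigr => h _.
by rewrite -KP_scalerAl -KP_scalerAr Uh_central.
Qed.

Definition iota_morph : {rmorphism C -> A} := HB.pack_for {rmorphism C -> A} iota
  (GRing.isNmodMorphism.Build C A iota iotaD)
  (GRing.isMonoidMorphism.Build C A iota iotaM).

Lemma iota_morphE (c : C) : iota_morph c = iota c. Proof. by []. Qed.

Lemma iota_scalar (z : K) (c : C) : iota (z *: c) = z *: iota c.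
Proof.
rewrite (iota_CE (msuppZ_le z c)) [in RHS]/iota_C scaler_sumr.
by apply: eq_bigr => h _; rewrite mcoeffZ scalerA.
Qed.

Variable sec : {additive 'rV[nat]_l -> 'rV[nat]_k}.
Hypothesis secK : cancel sec f.

(** The copy of the Kumjian-Pask algebra of Gamma in A, on the chosen lifts of
    degrees. *)
Definition base_s (lam : G) : A := S lam (sec (kgdeg lam)).
Definition base_t (lam : G) : A := T lam (sec (kgdeg lam)).

Lemma base_vertex v : base_s (kgid G v) = kp_p K P v.
Proof. by rewrite /base_s kgdeg_id raddf0; have [] := pb_vertex v. Qed.

Lemma base_family : kp_family base_s base_t.
Proof.
split=> [v|lam mu|lam mu|lam mu d|n].
- rewrite base_vertex /base_t kgdeg_id raddf0.
  by have [_] := pb_vertex v.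
- rewrite /base_s pb_ss //; case: eqP => // lm.
  by rewrite kgdeg_comp // raddfD.
- rewrite /base_t pb_tt //; case: eqP => // lm.
  by rewrite kgdeg_comp // raddfD.
- by rewrite base_vertex /base_s /base_t -d pb_ts // ?secK.
- rewrite -[RHS](pb_one (sec n)) secK big_seq [RHS]big_seq.
  by apply: eq_bigr => lam; rewrite mem_paths_of_degree // /base_s /base_t => /eqP ->.
Qed.

(** The element of the kernel by which a lift n of the degree of a path differs
    from the chosen one. *)
Definition shift (n : 'rV[nat]_k) : 'rV[int]_k := intv n - intv (sec (f n)).

Fact shift_ker n : shift n \in ker_fbar_pred f.
Proof. by rewrite unfold_in /shift fbar_diff secK subrr. Qed.

Definition ker_shift n : H := KerFbar (shift_ker n).

Lemma pb_s_base lam n : kgdeg lam = f n ->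
  S lam n = iota (ga_u K (ker_shift n)) * base_s lam.
Proof.
move=> dl; rewrite iota_U scale1r (@Uh_transfer _ n (sec (f n))) ?secK //.
by rewrite /base_s dl transfer_s ?secK.
Qed.

Lemma pb_t_base lam n : kgdeg lam = f n ->
  T lam n = iota (ga_u K (- ker_shift n)) * base_t lam.
Proof.
move=> dl; rewrite iota_U scale1r (@Uh_transfer _ (sec (f n)) n) ?secK //; last first.
  by rewrite /= /shift opprB.
by rewrite transfer_central ?secK // /base_t dl t_transfer ?secK.
Qed.

Local Notation span := (kpf_span base_s base_t iota_morph).

(** Left multiplication by each generator preserves the span, since s_(lam, n) and
    t_(lam, n) are multiples of base_s lam and base_t lam by elements of iota(C). *)
Lemma base_span (x : A) : exists n : 'rV[nat]_l, span n x.
Proof.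
have [rf bf] := (G_row_finite, base_family).
have ioc : forall (c : C) x, iota_morph c * x = x * iota_morph c by exact: iota_central.
suff H : forall (n : 'rV[nat]_l) (a : A), span n a -> exists m : 'rV[nat]_l, span m (x * a).
  rewrite -[x]mulr1; apply: (H 0); rewrite -(kpf_one bf 0) big_seq; apply: kpf_span_sum => lam.
  rewrite mem_paths_of_degree // => /eqP dl.
  by rewrite -[_ * _]mul1r -(rmorph1 iota_morph); apply: kpf_span_st.
move: x; apply: KP_ind => [v|lam|lam||x y IHx IHy|x IHx|z x IHx|x y IHx IHy] n a Ha.
- by exists n; rewrite -base_vertex; apply: kpf_span_s.
- exists n; have [-> _] := pb_val lam.
  rewrite pb_s_base; last exact: (eqP (valP lam)).
  by rewrite -mulrA -iota_morphE; apply: kpf_span_io; apply: kpf_span_s.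
- have [_ ->] := pb_val lam.
  rewrite pb_t_base; last exact: (eqP (valP lam)).
  rewrite -mulrA -iota_morphE; eexists; apply: kpf_span_io.
  exact: (kpf_span_t rf bf ioc _ Ha).
- by exists 0; rewrite mul0r; apply: kpf_span0.
- have [[m Hx] [m' Hy]] := (IHx n a Ha, IHy n a Ha).
  exists (m + m'); rewrite mulrDl; apply: kpf_spanD; first exact: kpf_span_addr.
  by rewrite addrC; apply: kpf_span_addr.
- have [m Hx] := IHx n a Ha; exists m.
  by rewrite -mulN1r -mulrA -(rmorph1 iota_morph) -rmorphN; apply: kpf_span_io.
- have [m Hx] := IHx n a Ha; exists m.
  have -> : z *: x * a = iota (z%:A) * (x * a).
    by rewrite iota_scalar -[iota 1]iota_morphE rmorph1 -!KP_scalerAl mul1r.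
  by rewrite -iota_morphE; apply: kpf_span_io.
- have [m Hy] := IHy n a Ha; have [m' Hx] := IHx m _ Hy; exists m'.
  by rewrite -[kp_mul x y]/(x * y) -mulrA.
Qed.

End Pullback.

(** * The representation on germs of functions on paths *)

Lemma ga_scaleU (K : fieldType) (H : zmodType) (a : K) (h : H) :
  a *: ga_u K h = << a *g h >> :> {malg K[H]}.
Proof. by apply/malgP => g; rewrite [LHS]mcoeffZ !mcoeffU mulrnAr mulr1. Qed.

Lemma ga_sumE (K : fieldType) (H : zmodType) (c : grpalg K H) :
  c = \sum_(h <- msupp c) (c@_h)%:A * ga_u K h.
Proof.
rewrite [LHS]monalgE; apply: eq_bigr => h _.
by rewrite -scalerAl mul1r; apply: esym; exact: ga_scaleU.
Qed.

Section Germs.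
Local Open Scope quotient_scope.
Variables (K : fieldType) (k l : nat) (V : finType).
Variables (f : {additive 'rV[nat]_k -> 'rV[nat]_l}) (G : kgraph l V).
Hypothesis G_row_finite : row_finite G.
Variables (C : comAlgType K) (twist untwist : 'rV[nat]_k -> C).
Hypotheses (twist0 : twist 0 = 1) (twistD : {morph twist : n m / n + m >-> n * m}).
Hypothesis twistK : forall n, twist n * untwist n = 1.

Local Notation P := (pullback f G).
Local Notation A := (KP K P).

Implicit Types (lam mu nu al be ga : G) (n m : 'rV[nat]_k) (phi psi : G -> C).

Definition path_tail lam al : option G :=
  if pselect (exists be, kgsrc lam = kgrng be /\ al = kgcomp lam be) is left e
  then Some (sval (cid e)) else None.

Lemma path_tailP lam al be :
  path_tail lam al = Some be <-> kgsrc lam = kgrng be /\ al = kgcomp lam be.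
Proof.
rewrite /path_tail; case: pselect => [e|ne]; last by split=> // H; case: ne; exists be.
case: (cid e) => be' /= [lb' E]; split=> [[<-]//|[lb E']].
by have [_ ->] := kg_cancel lb' lb erefl (etrans (esym E) E').
Qed.

Lemma path_tail_none lam al : path_tail lam al = None ->
  forall be, kgsrc lam = kgrng be -> al <> kgcomp lam be.
Proof.
by move=> tn be lb E; have [_ /(_ (conj lb E))] := path_tailP lam al be; rewrite tn.
Qed.

Lemma path_tail_id v al : path_tail (kgid G v) al = if kgrng al == v then Some al else None.
Proof.
case: eqP => [<-|nv]; first by apply/path_tailP; rewrite kgsrc_id kgcomp1l.
case tE: path_tail => [be|] //; have [+ E] := (path_tailP _ _ _).1 tE.
by rewrite kgsrc_id => vb; case: nv; rewrite E kgrng_comp ?kgrng_id ?kgsrc_id.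
Qed.

Lemma untwist0 : untwist 0 = 1.
Proof. by rewrite -[LHS]mul1r -twist0 twistK. Qed.

Lemma untwistD n m : untwist (n + m) = untwist n * untwist m.
Proof.
rewrite -[RHS]mul1r -(twistK (n + m)) twistD [_ * untwist (n + m)]mulrC -mulrA.
by rewrite mulrACA !twistK !mulr1.
Qed.

(** s_(lam, n) sends phi to the function supported on the paths that begin with
    lam, whose value at lam be is twist n * phi be; its adjoint sends phi to the
    function al -> untwist n * phi (lam al).  The twist records the degree n,
    which lam does not determine. *)
Fixpoint action (x : kp_term K P) phi al : C := match x with
  | KPv v => if kgrng al == v then phi al else 0
  | KPs y => if path_tail (val y).1 al is Some be then twist (val y).2 * phi be else 0
  | KPg y => if kgsrc (val y).1 == kgrng al
             then untwist (val y).2 * phi (kgcomp (val y).1 al) else 0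
  | KPzero => 0
  | KPadd y z => action y phi al + action z phi al
  | KPopp y => - action y phi al
  | KPscale a y => a%:A * action y phi al
  | KPmul y z => action y (action z phi) al
  end.

Lemma actionD x phi psi :
  action x (fun al => phi al + psi al) = fun al => action x phi al + action x psi al.
Proof.
elim: x phi psi => [v|y|y||y IHy z IHz|y IHy|a y IHy|y IHy z IHz] phi psi;
  apply/funext => al /=.
- by case: ifP; rewrite ?addr0.
- by case: path_tail => [be|]; rewrite ?mulrDr ?addr0.
- by case: ifP; rewrite ?mulrDr ?addr0.
- by rewrite addr0.
- by rewrite IHy IHz addrACA.
- by rewrite IHy opprD.
- by rewrite IHy mulrDr.
- by rewrite IHz IHy.
Qed.

Lemma actionM x c phi : action x (fun al => c * phi al) = fun al => c * action x phi al.
Proof.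
elim: x phi => [v|y|y||y IHy z IHz|y IHy|a y IHy|y IHy z IHz] phi;
  apply/funext => al /=.
- by case: ifP; rewrite ?mulr0.
- by case: path_tail => [be|]; rewrite ?mulr0 // mulrCA.
- by case: ifP; rewrite ?mulr0 // mulrCA.
- by rewrite mulr0.
- by rewrite IHy IHz mulrDr.
- by rewrite IHy mulrN.
- by rewrite IHy mulrCA.
- by rewrite IHz IHy.
Qed.

Variable J : set C.
Hypothesis idJ : two_sided_ideal J.

(** Equality of germs of functions with values in C / J. *)
Definition germ phi psi : Prop :=
  exists N, forall al, lev N (kgdeg al) -> J (phi al - psi al).

Let J0 : J 0. Proof. by have [] := idJ. Qed.
Let JD x y : J x -> J y -> J (x + y). Proof. by have [_ D _] := idJ; apply: D. Qed.
Let JM a x : J x -> J (a * x). Proof. by have [_ _ M] := idJ => Jx; have [] := M a x Jx. Qed.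
Let JN x : J x -> J (- x). Proof. exact: two_sided_idealN. Qed.

Lemma germ_eventually N phi psi :
  (forall al, lev N (kgdeg al) -> phi al = psi al) -> germ phi psi.
Proof. by move=> e; exists N => al /e ->; rewrite subrr. Qed.

Lemma germ_eq phi psi : (forall al, phi al = psi al) -> germ phi psi.
Proof. by move=> e; apply: (@germ_eventually 0). Qed.

Lemma germ_sym phi psi : germ phi psi -> germ psi phi.
Proof. by move=> [N E]; exists N => al /E/JN; rewrite opprB. Qed.

Lemma germ_trans psi phi chi : germ phi psi -> germ psi chi -> germ phi chi.
Proof.
move=> [N E] [M F]; exists (N + M) => al NM.
rewrite -(subrK (psi al) (phi al)) -addrA; apply: JD.
  by apply: E; apply: lev_trans NM; exact: lev_addr.
by apply: F; apply: lev_trans NM; rewrite addrC lev_addr.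
Qed.

Lemma germD phi psi phi' psi' : germ phi phi' -> germ psi psi' ->
  germ (fun al => phi al + psi al) (fun al => phi' al + psi' al).
Proof.
move=> [N E] [M F]; exists (N + M) => al NM.
rewrite opprD addrACA; apply: JD.
  by apply: E; apply: lev_trans NM; exact: lev_addr.
by apply: F; apply: lev_trans NM; rewrite addrC lev_addr.
Qed.

Lemma germM c phi psi : germ phi psi -> germ (fun al => c * phi al) (fun al => c * psi al).
Proof. by move=> [N E]; exists N => al /E; rewrite -mulrBr; apply: JM. Qed.

Lemma germN phi psi : germ phi psi -> germ (fun al => - phi al) (fun al => - psi al).
Proof. by move=> [N E]; exists N => al /E; rewrite -opprD; apply: JN. Qed.

(** The degree of a path is only changed by a bounded amount by each generator, so
    the action passes to germs. *)
Lemma action_germ x phi psi : germ phi psi -> germ (action x phi) (action x psi).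
Proof.
elim: x phi psi => [v|y|y||y IHy z IHz|y IHy|a y IHy|y IHy z IHz] phi psi E /=.
- have [N {}E] := E; exists N => al /E Eal /=.
  by case: ifP; rewrite ?subrr.
- have [N {}E] := E; exists (kgdeg (val y).1 + N) => al /=.
  case tE: path_tail => [be|]; last by rewrite subrr.
  have [lb ->] := (path_tailP _ _ _).1 tE; rewrite kgdeg_comp // -mulrBr => /levP[d D].
  apply: JM; apply: E; apply/levP; exists d; apply: (@rowN_addrI _ _ _ (kgdeg (val y).1)).
  by rewrite -D addrA.
- have [N {}E] := E; exists N => al Nal /=.
  case: eqP => [la|_]; last by rewrite subrr.
  rewrite -mulrBr; apply: JM; apply: E; rewrite kgdeg_comp //.
  by apply: lev_trans Nal _; rewrite addrC lev_addr.
- exact: germ_eq.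
- by apply: germD; [exact: IHy|exact: IHz].
- by apply: germN; exact: IHy.
- by apply: germM; exact: IHy.
- by apply: IHy; exact: IHz.
Qed.

Lemma action_sg (x y : P) phi al : (val x).1 = (val y).1 ->
  action (KPmul (KPs K x) (KPg K y)) phi al =
  if path_tail (val x).1 al then twist (val x).2 * untwist (val y).2 * phi al else 0.
Proof.
move=> xy /=; case tE: path_tail => [be|] //; have [lb ->] := (path_tailP _ _ _).1 tE.
by rewrite -xy lb eqxx mulrA.
Qed.

(** A path of degree at least f n begins with exactly one path of degree f n. *)
Lemma action_prefix_sum n al phi (c : C) : lev (f n) (kgdeg al) ->
  \sum_(lam <- paths_of_degree G (f n)) (if path_tail lam al then c * phi al else 0) = c * phi al.
Proof.
move=> /levP[d /esym/kg_factor[lam [be [lb E dl _]]]].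
rewrite (bigD1_seq lam) ?fset_uniq ?mem_paths_of_degree ?dl //=.
have -> : path_tail lam al = Some be by apply/path_tailP.
rewrite big_seq_cond big1 ?addr0 // => mu /andP[].
rewrite mem_paths_of_degree // => /eqP dm /eqP ml.
case tE: path_tail => [ga|] //; have [mg E'] := (path_tailP _ _ _).1 tE.
by exfalso; apply: ml; have [|] := kg_cancel mg lb _ (etrans (esym E') E); rewrite ?dm.
Qed.

(** All relations except (KP4) hold for functions; (KP4) in degree n holds on the
    paths of degree at least f n, by the factorisation property. *)
Lemma action_sound x y phi : kp_eq x y -> germ (action x phi) (action y phi).
Proof.
move=> xy; elim: xy phi => {x y}.
- by move=> x phi; apply: germ_eq.
- by move=> x y _ IH phi; apply: germ_sym.
- by move=> x y z _ IH _ IH' phi; apply: germ_trans (IH phi) (IH' phi).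
- by move=> x x' y y' _ IH _ IH' phi; apply: germD.
- by move=> x x' _ IH phi; apply: germN.
- by move=> a x x' _ IH phi; apply: germM.
- move=> x x' y y' _ IH _ IH' phi.
  by apply: germ_trans (IH (action y phi)) _; apply: action_germ; exact: IH'.
- by move=> x y z phi; apply: germ_eq => al /=; rewrite addrA.
- by move=> x y phi; apply: germ_eq => al /=; rewrite addrC.
- by move=> x phi; apply: germ_eq => al /=; rewrite add0r.
- by move=> x phi; apply: germ_eq => al /=; rewrite addNr.
- by move=> a b x phi; apply: germ_eq => al /=; rewrite mulrA -scalerAl mul1r scalerA.
- by move=> x phi; apply: germ_eq => al /=; rewrite scale1r mul1r.
- by move=> a x y phi; apply: germ_eq => al /=; rewrite mulrDr.
- by move=> a b x phi; apply: germ_eq => al /=; rewrite scalerDl mulrDl.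
- by move=> x y z phi; apply: germ_eq.
- by move=> x y z phi; apply: germ_eq.
- move=> x y z phi; apply: germ_eq => al.
  exact: (congr1 (@^~ al) (actionD x (action y phi) (action z phi))).
- by move=> a x y phi; apply: germ_eq.
- move=> a x y phi; apply: germ_eq => al.
  exact: (congr1 (@^~ al) (esym (actionM x a%:A (action y phi)))).
- move=> v phi; apply: germ_eq => al /=.
  by rewrite path_tail_id; case: ifP; rewrite ?twist0 ?mul1r.
- move=> v phi; apply: germ_eq => al /=.
  rewrite kgsrc_id untwist0 mul1r eq_sym; case: eqP => // <-.
  by rewrite kgcomp1l.
- by move=> v phi; apply: germ_eq => al /=; case: eqP.
- move=> v w vw phi; apply: germ_eq => al /=.
  by case: eqP => // ->; case: eqP.
- move=> x y xy phi; apply: germ_eq => al.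
  rewrite /= val_pb_comp //= twistD.
  case tx: (path_tail (val x).1 al) => [be|].
    have [xb ->] := (path_tailP _ _ _).1 tx.
    case ty: (path_tail (val y).1 be) => [ga|].
      have [yg E] := (path_tailP _ _ _).1 ty.
      suff -> : path_tail (kgcomp (val x).1 (val y).1) (kgcomp (val x).1 be) =
          Some ga by rewrite mulrA.
      by apply/path_tailP; rewrite E kgsrc_comp // kgcompA.
    case txy: path_tail => [ga|]; last by rewrite mulr0.
    have [] := (path_tailP _ _ _).1 txy; rewrite kgsrc_comp // => yg.
    rewrite -kgcompA // => /(kg_cancel xb)[]; rewrite ?kgrng_comp // => _ /(path_tail_none ty)[].
    exact: yg.
  case txy: path_tail => [ga|] //; have [] := (path_tailP _ _ _).1 txy; rewrite kgsrc_comp // => yg.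
  by rewrite -kgcompA // => /(path_tail_none tx)[]; rewrite kgrng_comp.
- move=> x y xy phi; apply: germ_eq => al.
  rewrite /= val_pb_comp //= untwistD kgsrc_comp //.
  case: eqP => // ya; rewrite kgrng_comp //.
  have -> : kgsrc (val x).1 = kgrng (val y).1 by exact: xy.
  by rewrite eqxx kgcompA // mulrA [untwist _ * untwist _]mulrC.
- move=> x phi; apply: germ_eq => al /=; case: eqP => // nr.
  case tx: path_tail => [be|] //; have [xb E] := (path_tailP _ _ _).1 tx.
  by case: nr; rewrite E kgrng_comp.
- move=> x phi; apply: germ_eq => al /=; case tx: path_tail => [be|] //.
  by have [xb E] := (path_tailP _ _ _).1 tx; rewrite /pb_src xb eqxx.
- by move=> x phi; apply: germ_eq => al /=; rewrite /pb_src eq_sym; case: eqP.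
- move=> x phi; apply: germ_eq => al /=; case: eqP => // xa.
  by rewrite kgrng_comp // /pb_rng eqxx.
- move=> x phi; apply: germ_eq => al /=; rewrite /pb_src eq_sym; case: eqP => // ax.
  have -> : path_tail (val x).1 (kgcomp (val x).1 al) = Some al by apply/path_tailP.
  by rewrite mulrA [untwist _ * _]mulrC twistK mul1r.
- move=> x y dxy nxy phi; apply: germ_eq => al /=; case: eqP => // xa.
  case ty: path_tail => [be|]; last by rewrite mulr0.
  have [yb E] := (path_tailP _ _ _).1 ty; case: nxy; apply: val_inj.
  have dxy' : kgdeg (val x).1 = kgdeg (val y).1.
    by rewrite (eqP (valP x)) (eqP (valP y)); congr (f _); exact: dxy.
  have [e1 _] := kg_cancel xa yb dxy' E.
  by rewrite [LHS]surjective_pairing [RHS]surjective_pairing e1; congr pair; exact: dxy.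
- move=> v n e n0 e_uniq eE phi; apply: (@germ_eventually (f n)) => al dal.
  have -> : action (\big[@KPadd K k V P/KPzero K P]_(x <- e) KPmul (KPs K x) (KPg K x)) phi al =
      \sum_(x <- e) action (KPmul (KPs K x) (KPg K x)) phi al.
    by elim: (e) => [|x r IH]; rewrite ?big_nil ?big_cons //= -IH.
  under eq_bigr do rewrite action_sg // twistK mul1r.
  have eP (x : P) : x \in e -> kgrng (val x).1 = v /\ (val x).2 = n by move/eE.
  rewrite /=; case: eqP => [ra|nra]; last first.
    rewrite big_seq big1 // => x /eP[rx _]; case tx: path_tail => [be|] //.
    have [xb E] := (path_tailP _ _ _).1 tx.
    by case: nra; rewrite E kgrng_comp.
  have /levP[d /esym/kg_factor[lam [be [lb E dl _]]]] := dal.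
  have [x [xE _ _]] := pb_lift K dl.
  have xe : x \in e.
    by apply/eE; split; rewrite /= ?/pb_rng ?/pb_deg xE //= -ra E kgrng_comp.
  rewrite (bigD1_seq x) //= xE /=.
  have -> : path_tail lam al = Some be by apply/path_tailP.
  rewrite big_seq_cond big1 ?addr0 // => y /andP[/eP[_ dy] yx].
  case ty: path_tail => [ga|] //; have [yg E'] := (path_tailP _ _ _).1 ty.
  case/eqP: yx; apply: val_inj; rewrite xE [LHS]surjective_pairing dy; congr pair.
  have [|] := kg_cancel yg lb _ (etrans (esym E') E) => //.
  by rewrite (eqP (valP y)) dl dy.
Qed.

Lemma kp_pi_ex (x : A) : exists y, x = \pi_A y.
Proof. by exists (repr x); rewrite reprK. Qed.

(** Phrased with a representative of x, so that no operator on a quotient space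
    has to be formed. *)
Definition acts (x : A) (F : (G -> C) -> G -> C) : Prop :=
  exists2 y, x = \pi_A y & forall phi, germ (action y phi) (F phi).

Lemma acts_uniq x F F' phi : acts x F -> acts x F' -> germ (F phi) (F' phi).
Proof.
move=> [y -> yF] [z /kp_piP/action_sound yz zF'].
exact: germ_trans (germ_sym (yF phi)) (germ_trans (yz phi) (zF' phi)).
Qed.

Lemma acts_germ x F F' : acts x F -> (forall phi, germ (F phi) (F' phi)) -> acts x F'.
Proof. by move=> [y -> yF] FF'; exists y => // phi; apply: germ_trans (FF' phi). Qed.

Lemma acts0 : acts 0 (fun=> fun=> 0).
Proof. by exists (KPzero K P) => // phi; apply: germ_eq. Qed.

Lemma actsD x x' F F' : acts x F -> acts x' F' ->
  acts (x + x') (fun phi al => F phi al + F' phi al).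
Proof.
move=> [y -> yF] [z -> zF']; exists (KPadd y z) => [|phi]; first exact: kp_addE.
exact: germD.
Qed.

Lemma actsZ a x F : acts x F -> acts (a *: x) (fun phi al => a%:A * F phi al).
Proof.
move=> [y -> yF]; exists (KPscale a y) => [|phi]; first exact: kp_scaleE.
exact: germM.
Qed.

Lemma acts_sum (I : eqType) (r : seq I) (x : I -> A) F :
  (forall i, i \in r -> acts (x i) (F i)) ->
  acts (\sum_(i <- r) x i) (fun phi al => \sum_(i <- r) F i phi al).
Proof.
elim: r => [|i r IH] xF.
  by rewrite big_nil; apply: (acts_germ acts0) => phi; apply: germ_eq => al; rewrite big_nil.
rewrite big_cons; apply: (@acts_germ _ (fun phi al => F i phi al + \sum_(j <- r) F j phi al)).
  by apply: actsD; [apply: xF; exact: mem_head|apply: IH => j jr; apply: xF; rewrite inE jr orbT].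
by move=> phi; apply: germ_eq => al; rewrite big_cons.
Qed.

Lemma acts_transfer n m : f n = f m ->
  acts (transfer K f G n m) (fun phi al => twist n * untwist m * phi al).
Proof.
move=> nm; apply: (@acts_germ _ (fun phi al => \sum_(lam <- paths_of_degree G (f n))
    if path_tail lam al then twist n * untwist m * phi al else 0)).
  apply: acts_sum => lam; rewrite mem_paths_of_degree // => /eqP dn.
  have [x [xE -> _]] := pb_lift K dn; rewrite nm in dn.
  have [y [yE _ ->]] := pb_lift K dn.
  exists (KPmul (KPs K x) (KPg K y)) => [|phi]; first exact: kp_mulE.
  by apply: germ_eq => al; rewrite action_sg xE yE.
move=> phi; apply: (@germ_eventually (f n)) => al; exact: action_prefix_sum.
Qed.

(** A sum of terms a c with c in J, applied to phi, gives the sum of the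
    c (a phi), which takes its values in J. *)
Lemma acts_mulspan (S : set A) x :
  (forall a, S a -> exists2 c, J c & acts a (fun phi al => c * phi al)) ->
  mulspan setT S x -> acts x (fun=> fun=> 0).
Proof.
move=> HS; move: x; apply: mulspan_sub; first exact: acts0.
  move=> x y x0 y0; apply: (acts_germ (actsD x0 y0)) => phi.
  by apply: germ_eq => al; rewrite addr0.
move=> x a _ /HS[c Jc [z -> zc]]; have [y ->] := kp_pi_ex x.
exists (KPmul y z) => [|phi]; first exact: kp_mulE.
apply: germ_trans (action_germ y (zc phi)) _.
by exists 0 => al _; rewrite actionM subr0 mulrC; apply: JM.
Qed.

(** Without sources there are paths of arbitrarily large degree to evaluate at. *)
Lemma germ_mul0 (c : C) : no_sources G -> (0 < #|V|)%N ->
  germ (fun=> c) (fun=> 0) -> J c.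
Proof.
move=> nsG /card_gt0P[v _] [N cN]; have [lam [_ dl]] := nsG v N.
by rewrite -[c]subr0; apply: (cN lam); rewrite dl lev_refl.
Qed.

End Germs.

Section ContractionExtension.
Variables (K : fieldType) (k l : nat) (V : finType).
Variables (f : {additive 'rV[nat]_k -> 'rV[nat]_l}) (G : kgraph l V).
Hypotheses (G_row_finite : row_finite G) (G_no_sources : no_sources G).
Variable V_nonempty : (0 < #|V|)%N.
Variable sec : {additive 'rV[nat]_l -> 'rV[nat]_k}.
Hypothesis secK : cancel sec f.

Local Notation A := (KP K (pullback f G)).
Local Notation H := (ker_fbar f).
Local Notation C := (grpalg K H).

Let uM (g h : H) : ga_u K g * ga_u K h = ga_u K (g + h) :> C.
Proof. exact: ga_uD. Qed.

Let u1 : ga_u K (0 : H) = 1 :> C.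
Proof. by []. Qed.

Definition twist n : C := ga_u K (ker_shift secK n).
Definition untwist n : C := ga_u K (- ker_shift secK n).

Lemma twist0 : twist 0 = 1.
Proof.
by rewrite -u1 /twist; congr ga_u; apply: val_inj; rewrite /= /shift !raddf0 subrr.
Qed.

Lemma twistD : {morph twist : n m / n + m >-> n * m}.
Proof.
move=> n m; rewrite /twist uM; congr ga_u; apply: val_inj => /=.
by rewrite /shift !raddfD !intvD opprD addrACA.
Qed.

Lemma twistK n : twist n * untwist n = 1.
Proof. by rewrite /twist /untwist uM subrr u1. Qed.

Variable J : set C.
Hypothesis idJ : two_sided_ideal J.

Local Notation acts := (acts twist untwist J).

Lemma acts_Uh (h : H) : acts (Uh K G h) (fun phi al => ga_u K h * phi al).
Proof.
rewrite Uh_posneg //.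
apply: (acts_germ idJ (acts_transfer G_row_finite twist untwist idJ (ker_f h))) => phi.
apply: (germ_eq idJ) => al; congr (_ * _); rewrite /twist /untwist uM; congr ga_u.
by apply: val_inj; rewrite /= /shift ker_f opprB addrA subrK [RHS]posv_negv.
Qed.

Lemma acts_iota (c : C) : acts (iota_C G c) (fun phi al => c * phi al).
Proof.
apply: (@acts_germ _ _ _ _ _ _ _ _ _ _ idJ _
  (fun phi al => \sum_(h <- msupp c) (c@_h)%:A * (ga_u K h * phi al))).
  by apply: (acts_sum idJ) => h _; apply: (actsZ idJ); exact: acts_Uh.
move=> phi; apply: (germ_eq idJ) => al.
by rewrite [in RHS](ga_sumE c) mulr_suml; apply: eq_bigr => h _; rewrite mulrA.
Qed.

(** The germ of the constant function 1 is sent to that of c and, modulo J, to 0. *)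
Lemma contraction_extension_sub (c : C) :
  mulspan setT (iota_C G @` J) (iota_C G c) -> J c.
Proof.
move=> cJ; apply: (germ_mul0 G_no_sources V_nonempty).
have H0 : acts (iota_C G c) (fun=> fun=> 0).
  by apply: (acts_mulspan idJ _ cJ) => _ [d Jd <-]; exists d => //; exact: acts_iota.
have := acts_uniq twist0 twistD twistK idJ (fun=> 1) (acts_iota c) H0.
by under eq_fun do rewrite mulr1.
Qed.

End ContractionExtension.

(** * Assembling the correspondence *)

(** A vector space spanned by a family indexed by a countable type is the union of
    the spans of the initial segments of one sequence. *)
Section CountableSpan.
Variables (K : pzRingType) (M : lmodType K) (I : countType) (b : I -> M).

Definition span_enum (i : nat) : M := oapp b 0 (choice.unpickle i).

Definition enum_spanned (x : M) : Prop :=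
  exists N (c : nat -> K), x = \sum_(i < N) c i *: span_enum i.

Lemma enum_spanned0 : enum_spanned 0.
Proof. by exists 0%N, (fun=> 0); rewrite big_ord0. Qed.

Lemma enum_spannedD x y : enum_spanned x -> enum_spanned y -> enum_spanned (x + y).
Proof.
have widen N N' (c : nat -> K) : (N <= N')%N ->
    \sum_(i < N) c i *: span_enum i = \sum_(i < N') (if (i < N)%N then c i else 0) *: span_enum i.
  move=> NN'; rewrite (big_ord_widen N' (fun i => c i *: span_enum i) NN') big_mkcond.
  by apply: eq_bigr => i _; case: ifP; rewrite ?scale0r.
move=> [N [c ->]] [N' [c' ->]].
exists (maxn N N'), (fun i => (if (i < N)%N then c i else 0) + (if (i < N')%N then c' i else 0)).
rewrite (widen _ _ c (leq_maxl N N')) (widen _ _ c' (leq_maxr N N')) -big_split.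
by apply: eq_bigr => i _; rewrite scalerDl.
Qed.

Lemma enum_spanned_gen z i : enum_spanned (z *: b i).
Proof.
exists (choice.pickle i).+1, (fun j => if j == choice.pickle i then z else 0).
rewrite big_ord_recr /= eqxx /span_enum choice.pickleK big1 ?add0r // => j _.
by rewrite ltn_eqF // scale0r.
Qed.

End CountableSpan.

Section Assembly.
Variables (K : fieldType) (k l : nat) (V : finType).
Variables (f : {additive 'rV[nat]_k -> 'rV[nat]_l}) (G : kgraph l V).
Hypotheses (V_nonempty : (0 < #|V|)%N) (G_row_finite : row_finite G).
Hypotheses (G_no_sources : no_sources G) (G_cofinal : cofinal G).
Hypothesis G_aperiodic : aperiodic G.
Variable sec : {additive 'rV[nat]_l -> 'rV[nat]_k}.
Hypothesis secK : cancel sec f.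

Local Notation A := (KP K (pullback f G)).
Local Notation H := (ker_fbar f).
Local Notation C := (grpalg K H).
Local Notation io := (iota_morph K f G_row_finite).
Local Notation s := (@base_s K k l V f G sec).
Local Notation t := (@base_t K k l V f G sec).

Let io_central (c : C) (a : A) : io c * a = a * io c.
Proof. exact: iota_central. Qed.

(** Each coefficient c of an element of I satisfies iota(c) p_v in I for some v, so
    it lies in the contraction of I. *)
Lemma extension_contraction (I : set A) : two_sided_ideal I ->
  extension io (contraction io I) = I.
Proof.
move=> idI; apply/seteqP; split; first by apply/extension_sub.
move=> a Ia; have [n an] := base_span G_row_finite secK a.
have bf := base_family K G_row_finite secK.
apply: (coefficients_isolated bf io_central G_aperiodic an).
move=> mu nu c v E.
apply: (cofinal_corner_full G_row_finite G_no_sources G_cofinal bf idI (io_central c) (v := v)).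
by rewrite -E; have [_ _ IM] := idI; apply: (IM _ _ _).2; apply: (IM _ _ _).1.
Qed.

Lemma contraction_extension (J : set C) : two_sided_ideal J ->
  contraction io (extension io J) = J.
Proof.
move=> idJ; apply/seteqP; split; last first.
  by have [+ _] := @extension_sub _ _ io _ J (extension_ideal io_central J); exact.
by move=> c; apply: (contraction_extension_sub G_row_finite G_no_sources V_nonempty secK idJ).
Qed.

Lemma countably_spanned : exists e : nat -> A, forall a, exists N (c : nat -> K),
  a = \sum_(i < N) io (c i)%:A * e i.
Proof.
pose b (x : 'rV[int]_k * (G * G)) : A :=
  transfer K f G (posv x.1) (negv x.1) * (s x.2.1 * t x.2.2).
exists (span_enum b) => a.
suff [N [c ->]] : enum_spanned b a.
  exists N, c; apply: eq_bigr => i _.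
  by rewrite iota_morphE iota_scalar // -[iota_C _ 1](iota_morphE G_row_finite) rmorph1
    -KP_scalerAl mul1r.
have [n] := base_span G_row_finite secK a; move: a.
apply: kpf_span_ind; [exact: enum_spanned0|exact: enum_spannedD|].
move=> c al be _ _; rewrite iota_morphE /iota_C mulr_suml.
elim/big_ind: _; [exact: enum_spanned0|exact: enum_spannedD|move=> h _].
rewrite -KP_scalerAl Uh_posneg //; exact: (enum_spanned_gen b c@_h (ker_val h, (al, be))).
Qed.

End Assembly.

Theorem theorem4p3 (K : fieldType) (k l : nat)
    (f : {additive 'rV[nat]_k -> 'rV[nat]_l})
    (f_surj : forall n : 'rV[nat]_l, exists m : 'rV[nat]_k, f m = n)
    (V : finType) (V_nonempty : (0 < #|V|)%N) (G : kgraph l V)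
    (G_row_finite : row_finite G) (G_no_sources : no_sources G)
    (G_cofinal : cofinal G) (G_aperiodic : aperiodic G) :
  let A := KP K (pullback f G) in
  let C := grpalg K (ker_fbar f) in
  [/\ forall J : set C, two_sided_ideal J -> ideal_AJ G J = ideal_JA G J,
      exists phi : Spec C -> Spec A,
        (forall J, sval (phi J) = ideal_AJ G (sval J)) /\ homeomorphism phi &
      exists psi : MaxSpec C -> Prim A,
        [/\ forall m, sval (psi m) = ideal_AJ G (sval m),
            homeomorphism_onto_image psi &
            ~ countable [set: K] -> GRing.closed_field_axiom K ->
              (forall P, exists m, psi m = P) /\ homeomorphism psi]].
Proof.
move=> A C; have [h hK] := additive_section f_surj.
pose io := iota_morph K f G_row_finite.
have ioc (c : C) (a : A) : io c * a = a * io c by exact: iota_central.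
have ext_contr := extension_contraction G_row_finite G_no_sources G_cofinal G_aperiodic hK.
have contr_ext := contraction_extension V_nonempty G_row_finite G_no_sources hK.
split.
- by move=> J _; exact: (extensionC ioc).
- exact: (spec_homeomorphism ioc (ext_contr K) (contr_ext K)).
have [psi [psiE psi_im psi_max]] :=
  maxspec_homeomorphism_onto_image ioc (ext_contr K) (contr_ext K).
exists psi; split=> // K_unc K_closed; apply: psi_max => -[P [M [simpM /= ->]]].
have [e e_span] := countably_spanned K G_row_finite hK.
exact: (annihilator_contraction_maximal ioc e_span K_unc K_closed simpM).
Qed.
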